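(* Let $G=\mathbb{Z}/p^n\mathbb{Z}$ for some prime $p$ and $n\ge 1$, and let $k$ be any field of characteristic $p$. Take the Krull dimension as a dimension function for $kG\text{-stab}$. Then $$\mathrm{Z}^{\Delta}_i(kG\text{-stab})=\mathrm{CH}^{\Delta}_i(kG\text{-stab})=0\quad\text{for all } i\neq 0$$ and $$\mathrm{Z}^{\Delta}_0(kG\text{-stab})=\mathrm{CH}^{\Delta}_0(kG\text{-stab})\cong\mathbb{Z}/p^n\mathbb{Z}.$$
   Context: A tensor triangulated category $\mathcal{K}$ is an essentially small triangulated category with a symmetric monoidal structure $(\otimes,\mathbb{I})$ such that $\otimes$ is exact in each variable. A prime ideal of $\mathcal{K}$ is a proper thick triangulated subcategory $\mathcal{P}$ with $\mathcal{K}\otimes\mathcal{P}\subset\mathcal{P}$ such that $A\otimes B\in\mathcal{P}$ implies $A\in\mathcal{P}$ or $B\in\mathcal{P}$. $\operatorname{Spc}(\mathcal{K})$ is the set of prime ideals, topologized by the basis of closed sets $\operatorname{supp}(A)=\{\mathcal{P}: A\notin\mathcal{P}\}$, $A\in\mathcal{K}$. The Krull dimension $\dim_{\mathrm{Krull}}(\mathcal{P})$ of $\mathcal{P}\in\operatorname{Spc}(\mathcal{K})$ is the maximal length $n$ of a chain of non-empty irreducible closed subsets $C_0\subsetneq\dots\subsetneq C_n=\overline{\{\mathcal{P}\}}$; for $V\subset\operatorname{Spc}(\mathcal{K})$, $\dim(V)=\sup_{\mathcal{P}\in V}\dim_{\mathrm{Krull}}(\mathcal{P})$ (so $\dim\emptyset=-\infty$),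 and for $l\in\mathbb{Z}$, $\mathcal{K}_{(l)}\subset\mathcal{K}$ is the full subcategory of objects $a$ with $\dim(\operatorname{supp}(a))\le l$. Write $(-)^{\natural}$ for idempotent completion and $\mathrm{K}_0$ for the Grothendieck group of a triangulated category. $\mathrm{Z}^{\Delta}_l(\mathcal{K}):=\mathrm{K}_0\big((\mathcal{K}_{(l)}/\mathcal{K}_{(l-1)})^{\natural}\big)$ (Verdier quotient). Let $\iota:\mathrm{K}_0(\mathcal{K}_{(l)})\to\mathrm{K}_0(\mathcal{K}_{(l+1)})$, $q:\mathrm{K}_0(\mathcal{K}_{(l)})\to\mathrm{K}_0(\mathcal{K}_{(l)}/\mathcal{K}_{(l-1)})$ and $j:\mathrm{K}_0(\mathcal{K}_{(l)}/\mathcal{K}_{(l-1)})\to\mathrm{Z}^{\Delta}_l(\mathcal{K})$ be induced by the inclusion, the Verdier quotient functor and the embedding into the idempotent completion. $\mathrm{CH}^{\Delta}_l(\mathcal{K}):=\mathrm{Z}^{\Delta}_l(\mathcal{K})/(j\circ q)(\ker \iota)$. $kG\text{-stab}$ is the stable category of the Frobenius category of finitely generated left $kG$-modules; it is a tensor triangulated category with tensor product induced by $\otimes_k$ (diagonal action) and unit $k$. *)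

(* Defs.v *)
From HB Require Import structures.
From mathcomp Require Import all_boot all_order all_algebra all_fingroup.
From mathcomp Require Import all_character.
From mathcomp Require Import all_classical all_reals topology.
From mathcomp Require Import freeg.

Set Implicit Arguments.
Unset Strict Implicit.
Unset Printing Implicit Defensive.

Import Order.TTheory GRing.Theory Num.Theory.
Local Open Scope classical_set_scope.
Local Open Scope ring_scope.

Reserved Notation "f ~= g" (at level 70, no associativity).
Reserved Notation "f ;; g" (at level 45, left associativity).

(* Morphisms are taken up to the equivalence [heq]: the Hom-set from [A] to
   [B] is [hom A B] modulo [heq].  Composition is in diagrammatic order. *)
Record category := Category {
  ob :> Type;
  hom : ob -> ob -> Type;
  heq : forall A B, hom A B -> hom A B -> Prop;
  idh : forall A, hom A A;
  comp : forall A B C, hom A B -> hom B C -> hom A C;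
  heq_refl : forall A B (f : hom A B), heq f f;
  heq_sym : forall A B (f g : hom A B), heq f g -> heq g f;
  heq_trans : forall A B (f g h : hom A B), heq f g -> heq g h -> heq f h;
  comp_heq : forall A B C (f f' : hom A B) (g g' : hom B C),
    heq f f' -> heq g g' -> heq (comp f g) (comp f' g');
  comp1h : forall A B (f : hom A B), heq (comp (idh A) f) f;
  comph1 : forall A B (f : hom A B), heq (comp f (idh B)) f;
  comphA : forall A B C D (f : hom A B) (g : hom B C) (h : hom C D),
    heq (comp f (comp g h)) (comp (comp f g) h)
}.

Arguments hom {c} A B.
Arguments heq {c A B} f g.
Arguments idh {c} A.
Arguments comp {c A B C} f g.
Notation "f ~= g" := (heq f g).
Notation "f ;; g" := (comp f g).

Section CategoryNotions.
Context {C : category}.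
Implicit Types A B D : C.

Definition inverse_of A B (f : hom A B) (g : hom B A) :=
  f ;; g ~= idh A /\ g ;; f ~= idh B.

Definition is_iso A B (f : hom A B) := exists g, inverse_of f g.

Definition is_zero A :=
  (forall B, exists f : hom A B, forall g, g ~= f) /\
  (forall B, exists f : hom B A, forall g, g ~= f).

(* In an additive category binary coproducts are direct sums, so that
   [is_direct_sum i j] states that [D] is the direct sum of [A] and [B]. *)
Definition is_direct_sum A B D (i : hom A D) (j : hom B D) :=
  forall X (f : hom A X) (g : hom B X),
    exists2 h : hom D X, i ;; h ~= f /\ j ;; h ~= g
      & forall h', i ;; h' ~= f -> j ;; h' ~= g -> h' ~= h.

End CategoryNotions.

Record shift_category := ShiftCategory {
  scat :> category;
  shift : scat -> scat;
  shifth : forall A B, hom A B -> hom (shift A) (shift B);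
  shift_heq : forall A B (f g : hom A B), f ~= g -> shifth f ~= shifth g;
  shift_id : forall A, shifth (idh A) ~= idh (shift A);
  shift_comp : forall A B C (f : hom A B) (g : hom B C),
    shifth (f ;; g) ~= shifth f ;; shifth g
}.

Arguments shift {s} A.
Arguments shifth {s A B} f.

Record triangle (T : shift_category) := Triangle {
  tri1 : T; tri2 : T; tri3 : T;
  tri12 : hom tri1 tri2;
  tri23 : hom tri2 tri3;
  tri31 : hom tri3 (shift tri1)
}.

Record triangle_map (T : shift_category) (X Y : triangle T) := TriangleMap {
  tmap1 : hom (tri1 X) (tri1 Y);
  tmap2 : hom (tri2 X) (tri2 Y);
  tmap3 : hom (tri3 X) (tri3 Y);
  tmap12 : tri12 X ;; tmap2 ~= tmap1 ;; tri12 Y;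
  tmap23 : tri23 X ;; tmap3 ~= tmap2 ;; tri23 Y;
  tmap31 : tri31 X ;; shifth tmap1 ~= tmap3 ;; tri31 Y
}.

Definition triangle_iso (T : shift_category) (X Y : triangle T) :=
  exists m : triangle_map X Y,
    [/\ is_iso (tmap1 m), is_iso (tmap2 m) & is_iso (tmap3 m)].

Definition triangle_retract (T : shift_category) (X Y : triangle T) :=
  exists (s : triangle_map X Y) (r : triangle_map Y X),
    [/\ tmap1 s ;; tmap1 r ~= idh _, tmap2 s ;; tmap2 r ~= idh _
      & tmap3 s ;; tmap3 r ~= idh _].

(* The data of a triangulated category: the suspension and the class of
   distinguished triangles.  The additive structure is determined by the
   underlying category.  None of the constructions below needs the axioms
   (TR1)-(TR4) in order to be defined. *)
Record tricat := Tricat {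
  tcat :> shift_category;
  dist : triangle tcat -> Prop
}.

Arguments dist {t} X.

(* The unit, the functoriality and the coherence of the tensor product do not
   enter the definition of the spectrum. *)
Record ttcat := Ttcat {
  ttri :> tricat;
  tens : ttri -> ttri -> ttri
}.

Arguments tens {t} A B.

Section FullSubcategory.
Variables (T : tricat) (P : set T) (Pshift : forall A, P A -> P (shift A)).

Definition full_cat : category := {|
  ob := {A : T | P A};
  hom A B := hom (sval A) (sval B);
  heq A B := @heq T (sval A) (sval B);
  idh A := idh (sval A);
  comp A B C := @comp T (sval A) (sval B) (sval C);
  heq_refl A B := @heq_refl T (sval A) (sval B);
  heq_sym A B := @heq_sym T (sval A) (sval B);
  heq_trans A B := @heq_trans T (sval A) (sval B);
  comp_heq A B C := @comp_heq T (sval A) (sval B) (sval C);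
  comp1h A B := @comp1h T (sval A) (sval B);
  comph1 A B := @comph1 T (sval A) (sval B);
  comphA A B C D := @comphA T (sval A) (sval B) (sval C) (sval D)
|}.

Definition full_shift_cat : shift_category := {|
  scat := full_cat;
  shift A := exist P (shift (sval A)) (Pshift (svalP A));
  shifth A B := @shifth T (sval A) (sval B);
  shift_heq A B := @shift_heq T (sval A) (sval B);
  shift_id A := @shift_id T (sval A);
  shift_comp A B C := @shift_comp T (sval A) (sval B) (sval C)
|}.

Definition full_triangle (X : triangle full_shift_cat) : triangle T :=
  @Triangle T _ _ _ (tri12 X) (tri23 X) (tri31 X).

Definition full_tricat : tricat :=
  {| tcat := full_shift_cat; dist X := dist (full_triangle X) |}.

End FullSubcategory.

Section Verdier.
Variables (T : tricat) (L : set T).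

(* The morphisms with cone in [L].  Over a triangulated category a suspension
   of a distinguished triangle is distinguished up to sign, so that the second
   clause is redundant if [L] is stable under suspension. *)
Inductive verdier_inv : forall A B : T, hom A B -> Prop :=
| VCone (X : triangle T) of dist X & L (tri3 X) : verdier_inv (tri12 X)
| VShift (A B : T) (s : hom A B) of verdier_inv s : verdier_inv (shifth s).

(* The localization of [T] at [verdier_inv], as the category freely generated
   by [T] and formal inverses of the morphisms in [verdier_inv]. *)
Inductive verdier_hom : T -> T -> Type :=
| VMap (A B : T) (f : hom A B) : verdier_hom A B
| VInv (A B : T) (s : hom A B) of verdier_inv s : verdier_hom B A
| VComp (A B C : T) (u : verdier_hom A B) (v : verdier_hom B C) :
    verdier_hom A C.

Inductive verdier_heq :
  forall A B : T, verdier_hom A B -> verdier_hom A B -> Prop :=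
| VRefl A B (u : verdier_hom A B) : verdier_heq u u
| VSym A B (u v : verdier_hom A B) of verdier_heq u v : verdier_heq v u
| VTrans A B (u v w : verdier_hom A B) of
    verdier_heq u v & verdier_heq v w : verdier_heq u w
| VCongr A B C (u u' : verdier_hom A B) (v v' : verdier_hom B C) of
    verdier_heq u u' & verdier_heq v v' :
    verdier_heq (VComp u v) (VComp u' v')
| V1h A B (u : verdier_hom A B) : verdier_heq (VComp (VMap (idh A)) u) u
| Vh1 A B (u : verdier_hom A B) : verdier_heq (VComp u (VMap (idh B))) u
| VA A B C D (u : verdier_hom A B) (v : verdier_hom B C)
    (w : verdier_hom C D) :
    verdier_heq (VComp u (VComp v w)) (VComp (VComp u v) w)
| VMapHeq A B (f g : hom A B) of f ~= g : verdier_heq (VMap f) (VMap g)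
| VMapComp A B C (f : hom A B) (g : hom B C) :
    verdier_heq (VMap (f ;; g)) (VComp (VMap f) (VMap g))
| VInvR A B (s : hom A B) (hs : verdier_inv s) :
    verdier_heq (VComp (VMap s) (VInv hs)) (VMap (idh A))
| VInvL A B (s : hom A B) (hs : verdier_inv s) :
    verdier_heq (VComp (VInv hs) (VMap s)) (VMap (idh B)).

Definition verdier_cat : category := {|
  ob := T;
  hom := verdier_hom;
  heq := verdier_heq;
  idh A := VMap (idh A);
  comp := VComp;
  heq_refl := VRefl;
  heq_sym := VSym;
  heq_trans := VTrans;
  comp_heq := VCongr;
  comp1h := V1h;
  comph1 := Vh1;
  comphA := VA
|}.

Fixpoint verdier_shifth A B (u : verdier_hom A B) :
    verdier_hom (shift A) (shift B) :=
  match u with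
  | VMap _ _ f => VMap (shifth f)
  | VInv _ _ _ hs => VInv (VShift hs)
  | VComp _ _ _ u v => VComp (verdier_shifth u) (verdier_shifth v)
  end.

Lemma verdier_shift_heq A B (u v : verdier_hom A B) :
  verdier_heq u v -> verdier_heq (verdier_shifth u) (verdier_shifth v).
Proof.
elim=> {A B u v} /=.
- by move=> A B u; exact: VRefl.
- by move=> A B u v _; exact: VSym.
- by move=> A B u v w _ uv _; exact: VTrans.
- by move=> A B C u u' v v' _ uu' _; exact: VCongr.
- move=> A B u; apply: VTrans (V1h _).
  by apply: VCongr (VRefl _); apply: VMapHeq; exact: shift_id.
- move=> A B u; apply: VTrans (Vh1 _).
  by apply: VCongr; [exact: VRefl | apply: VMapHeq; exact: shift_id].
- by move=> *; exact: VA.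
- by move=> A B f g fg; apply: VMapHeq; exact: shift_heq.
- move=> A B C f g; apply: VTrans (VMapComp _ _).
  by apply: VMapHeq; exact: shift_comp.
- move=> A B s hs; apply: VTrans (VInvR _) _.
  by apply: VMapHeq; apply: heq_sym; exact: shift_id.
- move=> A B s hs; apply: VTrans (VInvL _) _.
  by apply: VMapHeq; apply: heq_sym; exact: shift_id.
Qed.

Definition verdier_shift_cat : shift_category := {|
  scat := verdier_cat;
  shift := @shift T;
  shifth := verdier_shifth;
  shift_heq := verdier_shift_heq;
  shift_id A := VMapHeq (shift_id A);
  shift_comp A B C u v := VRefl _
|}.

Definition verdier_triangle (X : triangle T) : triangle verdier_shift_cat :=
  @Triangle verdier_shift_cat _ _ _
    (VMap (tri12 X)) (VMap (tri23 X)) (VMap (tri31 X)).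

Definition verdier : tricat := {|
  tcat := verdier_shift_cat;
  dist Y := exists2 X : triangle T, dist X & triangle_iso (verdier_triangle X) Y
|}.

End Verdier.

Section IdempotentCompletion.
Variable T : tricat.

Record karoubi_ob := KaroubiOb {
  kob : T;
  kidem : hom kob kob;
  kidemP : kidem ;; kidem ~= kidem
}.

Record karoubi_hom (X Y : karoubi_ob) := KaroubiHom {
  kmap : hom (kob X) (kob Y);
  kmapP : (kidem X ;; kmap) ;; kidem Y ~= kmap
}.

Lemma kmapl X Y (f : karoubi_hom X Y) : kidem X ;; kmap f ~= kmap f.
Proof.
have e := kmapP f; apply: heq_trans (comp_heq (heq_refl _) (heq_sym e)) _.
apply: heq_trans e; apply: heq_trans (comphA _ _ _) _.
apply: comp_heq (heq_refl _); apply: heq_trans (comphA _ _ _) _.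
by apply: comp_heq (heq_refl _); exact: kidemP.
Qed.

Lemma kmapr X Y (f : karoubi_hom X Y) : kmap f ;; kidem Y ~= kmap f.
Proof.
have e := kmapP f; apply: heq_trans (comp_heq (heq_sym e) (heq_refl _)) _.
apply: heq_trans e; apply: heq_trans (heq_sym (comphA _ _ _)) _.
by apply: comp_heq (heq_refl _) _; exact: kidemP.
Qed.

Lemma karoubi_idP X : (kidem X ;; kidem X) ;; kidem X ~= kidem X.
Proof.
exact: heq_trans (comp_heq (kidemP X) (heq_refl _)) (kidemP X).
Qed.

Lemma karoubi_compP X Y Z (f : karoubi_hom X Y) (g : karoubi_hom Y Z) :
  (kidem X ;; (kmap f ;; kmap g)) ;; kidem Z ~= kmap f ;; kmap g.
Proof.
apply: heq_trans (comp_heq (comphA _ _ _) (heq_refl _)) _.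
apply: heq_trans (heq_sym (comphA _ _ _)) _.
by apply: comp_heq; [exact: kmapl | exact: kmapr].
Qed.

Definition karoubi_cat : category := {|
  ob := karoubi_ob;
  hom := karoubi_hom;
  heq X Y f g := kmap f ~= kmap g;
  idh X := KaroubiHom (karoubi_idP X);
  comp X Y Z f g := KaroubiHom (karoubi_compP f g);
  heq_refl X Y f := heq_refl (kmap f);
  heq_sym X Y f g := @heq_sym T _ _ (kmap f) (kmap g);
  heq_trans X Y f g h := @heq_trans T _ _ (kmap f) (kmap g) (kmap h);
  comp_heq X Y Z f f' g g' :=
    @comp_heq T _ _ _ (kmap f) (kmap f') (kmap g) (kmap g');
  comp1h X Y f := kmapl f;
  comph1 X Y f := kmapr f;
  comphA X Y Z W f g h := comphA (kmap f) (kmap g) (kmap h)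
|}.

Lemma karoubi_shiftP X :
  shifth (kidem X) ;; shifth (kidem X) ~= shifth (kidem X).
Proof.
apply: heq_trans (heq_sym (shift_comp _ _)) _.
by apply: shift_heq; exact: kidemP.
Qed.

Lemma karoubi_shifthP X Y (f : karoubi_hom X Y) :
  (shifth (kidem X) ;; shifth (kmap f)) ;; shifth (kidem Y) ~= shifth (kmap f).
Proof.
apply: heq_trans (comp_heq (heq_sym (shift_comp _ _)) (heq_refl _)) _.
apply: heq_trans (heq_sym (shift_comp _ _)) _.
by apply: shift_heq; exact: kmapP.
Qed.

Definition karoubi_shift X := KaroubiOb (karoubi_shiftP X).

Definition karoubi_shift_cat : shift_category := {|
  scat := karoubi_cat;
  shift := karoubi_shift : karoubi_cat -> karoubi_cat;
  shifth X Y f :=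
    @KaroubiHom (karoubi_shift X) (karoubi_shift Y) _ (karoubi_shifthP f);
  shift_heq X Y f g := @shift_heq T _ _ (kmap f) (kmap g);
  shift_id X := heq_refl (shifth (kidem X));
  shift_comp X Y Z f g := shift_comp (kmap f) (kmap g)
|}.

Definition karoubi_emb (A : T) : karoubi_ob := KaroubiOb (comp1h (idh A)).

Lemma karoubi_emb_homP (A B : T) (f : hom A B) (e : hom A A) (e' : hom B B) :
  e ~= idh A -> e' ~= idh B -> (e ;; f) ;; e' ~= f.
Proof.
move=> e1 e'1; apply: heq_trans (comph1 f); apply: comp_heq => //.
by apply: heq_trans (comp1h f); apply: comp_heq => //; exact: heq_refl.
Qed.

Definition karoubi_emb_hom (A B : T) (f : hom A B) :
    karoubi_hom (karoubi_emb A) (karoubi_emb B) :=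
  @KaroubiHom (karoubi_emb A) (karoubi_emb B) f
    (karoubi_emb_homP f (heq_refl _) (heq_refl _)).

Definition karoubi_emb_hom_shift (A B : T) (f : hom A (shift B)) :
    karoubi_hom (karoubi_emb A) (karoubi_shift (karoubi_emb B)) :=
  @KaroubiHom (karoubi_emb A) (karoubi_shift (karoubi_emb B)) f
    (karoubi_emb_homP f (heq_refl _) (shift_id B)).

Definition karoubi_triangle (X : triangle T) : triangle karoubi_shift_cat :=
  @Triangle karoubi_shift_cat
    (karoubi_emb (tri1 X)) (karoubi_emb (tri2 X)) (karoubi_emb (tri3 X))
    (karoubi_emb_hom (tri12 X)) (karoubi_emb_hom (tri23 X))
    (karoubi_emb_hom_shift (tri31 X)).

(* The distinguished triangles are the direct factors of the distinguished
   triangles of [T] (Balmer-Schlichting). *)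
Definition karoubi : tricat := {|
  tcat := karoubi_shift_cat;
  dist Y :=
    exists2 X : triangle T, dist X & triangle_retract Y (karoubi_triangle X)
|}.

End IdempotentCompletion.

Section GeneratedSubgroup.
Variables (M : zmodType) (S : set M).

Definition subgroup_gen : {pred M} := fun x =>
  `[< forall H : zmodClosed M, (forall s, S s -> s \in H) -> x \in H >].

Lemma subgroup_gen_closed : zmod_closed subgroup_gen.
Proof.
split=> [|x y /asboolP xS /asboolP yS]; apply/asboolP=> H SH.
  exact: rpred0.
by rewrite rpredB ?xS ?yS.
Qed.

HB.instance Definition _ :=
  GRing.isZmodClosed.Build M subgroup_gen subgroup_gen_closed.

Lemma mem_subgroup_gen s : S s -> s \in subgroup_gen.
Proof. by move=> Ss; apply/asboolP=> H; apply. Qed.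

Lemma subgroup_gen_min (H : zmodClosed M) :
  (forall s, S s -> s \in H) -> {subset subgroup_gen <= H}.
Proof. by move=> SH x /asboolP; apply. Qed.

End GeneratedSubgroup.

Section QuotientLift.
Variables (M N : zmodType) (H : zmodClosed M) (f : {additive M -> N}).

Definition quot_lift of (forall x, x \in H -> f x = 0) :=
  fun x : Quotient.quot H => f (generic_quotient.repr x).

Hypothesis fH : forall x, x \in H -> f x = 0.

Lemma quot_liftE x : quot_lift fH (\pi_(Quotient.quot H) x)%qT = f x.
Proof.
apply/eqP; rewrite -subr_eq0 -raddfB; apply/eqP/fH.
by rewrite Quotient.idealrBE reprK.
Qed.

Lemma quot_lift_is_additive : zmod_morphism (quot_lift fH).
Proof.
move=> x y; rewrite -[x]reprK -[y]reprK -raddfB.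
by rewrite !quot_liftE raddfB.
Qed.

HB.instance Definition _ :=
  GRing.isZmodMorphism.Build _ _ (quot_lift fH) quot_lift_is_additive.

End QuotientLift.

Section GrothendieckGroup.
Variable T : tricat.

Definition free_ob : zmodType := {freeg {classic T} / int}.

Definition free_class (A : T) : free_ob :=
  << (A : {classic T}) >>.

Definition K0_relations : set free_ob :=
  [set free_class (tri2 X) - free_class (tri1 X) - free_class (tri3 X)
    | X in [set X : triangle T | dist X]].

Definition K0 : zmodType := Quotient.quot (subgroup_gen K0_relations).

Definition K0_class (A : T) : K0 := (\pi_K0 (free_class A))%qT.

End GrothendieckGroup.

Section K0Lift.
Variables (T : tricat) (N : zmodType) (f : T -> N).
Hypothesis f_dist :
  forall X : triangle T, dist X -> f (tri2 X) = f (tri1 X) + f (tri3 X).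

Definition free_lift : free_ob T -> N :=
  @fglift int (zmodule N) {classic T} f.

Lemma free_lift_is_additive : zmod_morphism free_lift.
Proof. exact: (@lift_is_additive int {classic T} (zmodule N) f). Qed.

HB.instance Definition _ :=
  GRing.isZmodMorphism.Build _ _ free_lift free_lift_is_additive.

Lemma free_liftE A : free_lift (free_class A) = f A.
Proof. by rewrite /free_lift liftU; exact: (@scale1r int (zmodule N)). Qed.

Lemma free_lift0 x : x \in subgroup_gen (@K0_relations T) -> free_lift x = 0.
Proof.
move=> /asboolP; pose H : {pred free_ob T} := fun x => free_lift x == 0.
have Hz : zmod_closed H.
  split=> [|y z /eqP y0 /eqP z0]; apply/eqP; first exact: raddf0.
  by rewrite raddfB /= y0 z0 subr0.
pose HM := GRing.isZmodClosed.Build _ H Hz.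
pose HH : zmodClosed (free_ob T) := HB.pack H HM.
move=> /(_ HH) h; apply/eqP/h => _ [X dX <-].
apply/eqP; rewrite 2!raddfB /= !free_liftE f_dist //.
by rewrite addrAC addrK subrr.
Qed.

Definition K0_lift : {additive K0 T -> N} := quot_lift (f := free_lift) free_lift0.

Lemma K0_liftE A : K0_lift (K0_class A) = f A.
Proof.
exact: etrans (quot_liftE (f := free_lift) free_lift0 _) (free_liftE A).
Qed.

End K0Lift.

Lemma K0_dist (T : tricat) (X : triangle T) : dist X ->
  K0_class (tri2 X) = K0_class (tri1 X) + K0_class (tri3 X).
Proof.
move=> dX; rewrite /K0_class -raddfD; apply/eqP.
rewrite -Quotient.idealrBE opprD addrA.
by apply: mem_subgroup_gen; exists X.
Qed.

Section K0Map.
Variables (T U : tricat) (F : T -> U).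
Hypothesis F_exact : forall X : triangle T, dist X ->
  exists (f : hom (F (tri1 X)) (F (tri2 X))) (g : hom (F (tri2 X)) (F (tri3 X)))
    (h : hom (F (tri3 X)) (shift (F (tri1 X)))), dist (Triangle f g h).

Lemma K0_map_dist (X : triangle T) : dist X ->
  K0_class (F (tri2 X)) = K0_class (F (tri1 X)) + K0_class (F (tri3 X)).
Proof. by case/F_exact=> f [g [h /K0_dist]]. Qed.

Definition K0_map : {additive K0 T -> K0 U} := K0_lift (f := fun A => K0_class (F A)) K0_map_dist.

Lemma K0_mapE A : K0_map (K0_class A) = K0_class (F A).
Proof. exact: K0_liftE. Qed.

End K0Map.

Section TriangleIdentity.
Variables (T : shift_category) (X : triangle T).

Lemma comp_idC (A B : T) (f : hom A B) : f ;; idh B ~= idh A ;; f.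
Proof. exact: heq_trans (comph1 _) (heq_sym (comp1h _)). Qed.

Lemma comp_shift_idC : tri31 X ;; shifth (idh (tri1 X)) ~= idh _ ;; tri31 X.
Proof.
apply: heq_trans (comp_idC _).
by apply: comp_heq (shift_id _); exact: heq_refl.
Qed.

Definition triangle_id : triangle_map X X :=
  TriangleMap (comp_idC _) (comp_idC _) comp_shift_idC.

Lemma triangle_iso_refl : triangle_iso X X.
Proof.
by exists triangle_id; split; eexists; split; exact: comp1h.
Qed.

Lemma triangle_retract_refl : triangle_retract X X.
Proof. by exists triangle_id, triangle_id; split; exact: comp1h. Qed.

End TriangleIdentity.

Lemma verdier_exact (T : tricat) (L : set T) (X : triangle T) : dist X ->
  exists (f : verdier_hom L (tri1 X) (tri2 X))
    (g : verdier_hom L (tri2 X) (tri3 X))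
    (h : verdier_hom L (tri3 X) (shift (tri1 X))),
    @dist (verdier L) (@Triangle (verdier L) _ _ _ f g h).
Proof.
move=> dX; exists (VMap L (tri12 X)), (VMap L (tri23 X)), (VMap L (tri31 X)).
by exists X => //; exact: triangle_iso_refl.
Qed.

Lemma karoubi_exact (T : tricat) (X : triangle T) : dist X ->
  exists (f : karoubi_hom (karoubi_emb (tri1 X)) (karoubi_emb (tri2 X)))
    (g : karoubi_hom (karoubi_emb (tri2 X)) (karoubi_emb (tri3 X)))
    (h : karoubi_hom (karoubi_emb (tri3 X))
           (karoubi_shift (karoubi_emb (tri1 X)))),
    @dist (karoubi T) (@Triangle (karoubi T) _ _ _ f g h).
Proof.
move=> dX.
exists (karoubi_emb_hom (tri12 X)), (karoubi_emb_hom (tri23 X)),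
  (karoubi_emb_hom_shift (tri31 X)).
by exists X => //; exact: triangle_retract_refl.
Qed.

Section Spectrum.
Variable K : ttcat.

Definition thick (P : set K) :=
  [/\ forall A, is_zero A -> P A,
      forall A, P (shift A) <-> P A,
      forall X : triangle K, dist X ->
        [/\ P (tri1 X) -> P (tri2 X) -> P (tri3 X),
            P (tri2 X) -> P (tri3 X) -> P (tri1 X)
          & P (tri1 X) -> P (tri3 X) -> P (tri2 X)]
    & forall A B D (i : hom A D) (j : hom B D),
        is_direct_sum i j -> P D -> P A /\ P B].

Definition prime_ideal (P : set K) :=
  [/\ thick P, forall A B, P B -> P (tens A B), exists A, ~ P A
    & forall A B, P (tens A B) -> P A \/ P B].

Record Spc := MkSpc { prime_pred : set K; prime_predP : prime_ideal prime_pred }.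

Definition supp (A : K) : set Spc := [set P | ~ prime_pred P A].

HB.instance Definition _ := gen_eqMixin Spc.
HB.instance Definition _ := gen_choiceMixin Spc.

(* The closed sets are generated by the supports.  In a tensor triangulated
   category the sets [~` supp A] are stable under
   finite intersections (take direct sums), hence they form a base. *)
HB.instance Definition _ :=
  @isSubBaseTopological.Build Spc (set Spc) [set ~` supp A | A in setT] id.

End Spectrum.

Section KrullDimension.
Variable X : topologicalType.

Definition irreducible_closed (C : set X) :=
  [/\ closed C, C !=set0 & forall A B, closed A -> closed B ->
    C `<=` A `|` B -> C `<=` A \/ C `<=` B].

Definition chain_to (x : X) (n : nat) (c : nat -> set X) :=
  [/\ forall i, (i <= n)%N -> irreducible_closed (c i),
      forall i, (i < n)%N -> c i `<` c i.+1
    & c n = closure [set x]].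

(* [supremum -oo] is the supremum in [\bar int], that is Z with [-oo] and
   [+oo], where every set has one; the supremum of the empty set is [-oo]. *)
Definition krull_dim (x : X) : \bar int :=
  supremum -oo%E [set n%:Z%:E | n in [set n | exists c, chain_to x n c]].

Definition dim (V : set X) : \bar int :=
  supremum -oo%E [set krull_dim x | x in V].

End KrullDimension.

Section CycleGroups.
Variable K : ttcat.

Definition dim_le (l : int) : set K := [set a | (dim (supp a) <= l%:E)%E].

Lemma supp_shift (a : K) : supp (shift a) = supp a.
Proof.
apply/seteqP; split=> P /= nPa Pa; apply: nPa;
  have [[_ sh _ _] _ _ _] := prime_predP P; exact/sh.
Qed.

Lemma dim_le_shift l a : dim_le l a -> dim_le l (shift a).
Proof. by rewrite /dim_le /= supp_shift. Qed.

Lemma dim_le_succ l a : dim_le l a -> dim_le (l + 1) a.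
Proof. by move=> /le_trans; apply; rewrite lee_fin lerDl. Qed.

(* K_(l), as a triangulated category in its own right *)
Definition Kfilt (l : int) : tricat := full_tricat (@dim_le_shift l).

(* K_(l) / K_(l-1) *)
Definition Kquo (l : int) : tricat :=
  @verdier (Kfilt l) [set a | dim_le (l - 1) (sval a)].

Definition Zcyc (l : int) : zmodType := K0 (karoubi (Kquo l)).

Lemma Kincl_exact l (X : triangle (Kfilt l)) (F := fun a : Kfilt l =>
    exist _ (sval a) (dim_le_succ (svalP a)) : Kfilt (l + 1)) : dist X ->
  exists (f : hom (F (tri1 X)) (F (tri2 X))) (g : hom (F (tri2 X)) (F (tri3 X)))
    (h : hom (F (tri3 X)) (shift (F (tri1 X)))), dist (Triangle f g h).
Proof. by exists (tri12 X), (tri23 X), (tri31 X). Qed.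

Definition iota (l : int) : {additive K0 (Kfilt l) -> K0 (Kfilt (l + 1))} :=
  K0_map (@Kincl_exact l).

Definition quo_map (l : int) : {additive K0 (Kfilt l) -> K0 (Kquo l)} :=
  @K0_map (Kfilt l) (Kquo l) id (@verdier_exact (Kfilt l) _).

Definition idem_map (l : int) : {additive K0 (Kquo l) -> Zcyc l} :=
  @K0_map (Kquo l) (karoubi (Kquo l)) (@karoubi_emb (Kquo l))
    (@karoubi_exact (Kquo l)).

(* The image under [idem_map l \o quo_map l] of the kernel of [iota l] *)
Definition rat_equiv0 (l : int) : {pred Zcyc l} := fun z =>
  `[< exists2 x, iota l x = 0 & z = idem_map l (quo_map l x) >].

Lemma rat_equiv0_closed l : zmod_closed (@rat_equiv0 l).
Proof.
split=> [|y z /asboolP[u u0 ->] /asboolP[v v0 ->]]; apply/asboolP.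
  by exists 0; rewrite !raddf0.
exists (u - v); last by rewrite !raddfB.
by apply: etrans (raddfB (iota l) u v) _; rewrite u0 v0 subr0.
Qed.

HB.instance Definition _ l :=
  GRing.isZmodClosed.Build (Zcyc l) (@rat_equiv0 l) (@rat_equiv0_closed l).

Definition CHow (l : int) : zmodType := Quotient.quot (@rat_equiv0 l).

Definition cyc_class (l : int) (z : Zcyc l) : CHow l := (\pi_(CHow l) z)%qT.

End CycleGroups.

(* Finitely generated modules are finite dimensional, and are given in
   coordinates by matrix representations acting on row vectors: the module of
   [M : representation F G] is ['rV_(rdegree M)], with [g] acting by
   [v |-> v *m M g].  This is a right action, i.e. the left action
   [g v = v *m M g^-1]; a homomorphism is given by right multiplication by an
   intertwining matrix, and its kernel and image are row spaces. *)
Section StableCategory.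
Variables (F : fieldType) (gT : finGroupType) (G : {group gT}).
Local Notation rep := (representation F G).

Record modhom (M N : rep) := ModHom {
  mmx : 'M[F]_(rdegree M, rdegree N);
  mmxP : forall g, g \in G -> M g *m mmx = mmx *m N g
}.

Definition mod_surj (M N : rep) (f : modhom M N) := row_full (mmx f).

Definition short_exact (A B C : rep) (f : modhom A B) (g : modhom B C) :=
  [/\ row_free (mmx f), mod_surj g & (mmx f :=: kermx (mmx g))%MS].

Definition projective (P : rep) :=
  forall (M N : rep) (e : modhom M N) (f : modhom P N), mod_surj e ->
    exists l : modhom P M, mmx l *m mmx e = mmx f.

Definition stable_eq (M N : rep) (f g : modhom M N) :=
  exists (P : rep) (a : modhom M P) (b : modhom P N),
    projective P /\ mmx f - mmx g = mmx a *m mmx b.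

Lemma mod_idP (M : rep) g : g \in G -> M g *m 1%:M = 1%:M *m M g.
Proof. by rewrite mulmx1 mul1mx. Qed.

Definition mod_id (M : rep) : modhom M M := ModHom (@mod_idP M).

Lemma mod_compP (M N P : rep) (f : modhom M N) (h : modhom N P) g :
  g \in G -> M g *m (mmx f *m mmx h) = mmx f *m mmx h *m P g.
Proof. by move=> Gg; rewrite mulmxA mmxP // -!mulmxA mmxP. Qed.

Definition mod_comp (M N P : rep) (f : modhom M N) (h : modhom N P) :=
  ModHom (mod_compP f h).

Lemma mod_oppP (M N : rep) (f : modhom M N) g :
  g \in G -> M g *m (- mmx f) = - mmx f *m N g.
Proof. by move=> Gg; rewrite mulmxN mulNmx mmxP. Qed.

Definition mod_opp (M N : rep) (f : modhom M N) := ModHom (mod_oppP f).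

Lemma mod_rowP (M P Q : rep) (f : modhom M P) (h : modhom M Q) g :
  g \in G ->
  M g *m row_mx (mmx f) (mmx h) = row_mx (mmx f) (mmx h) *m dadd_grepr P Q g.
Proof.
move=> Gg; rewrite mul_mx_row !mmxP //= mul_row_block !mulmx0.
by rewrite addr0 add0r.
Qed.

Definition mod_row (M P Q : rep) (f : modhom M P) (h : modhom M Q) :
  modhom M (dadd_grepr P Q) := @ModHom M (dadd_grepr P Q) _ (mod_rowP f h).

Lemma mod_colP (M P Q : rep) (f : modhom P M) (h : modhom Q M) g :
  g \in G ->
  dadd_grepr P Q g *m col_mx (mmx f) (mmx h) = col_mx (mmx f) (mmx h) *m M g.
Proof.
move=> Gg; rewrite [RHS]mul_col_mx -(mmxP f) // -(mmxP h) //= mul_block_col !mul0mx.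
by rewrite addr0 add0r.
Qed.

Definition mod_col (M P Q : rep) (f : modhom P M) (h : modhom Q M) :
  modhom (dadd_grepr P Q) M := @ModHom (dadd_grepr P Q) M _ (mod_colP f h).

Lemma mod_inlP (P Q : rep) g : g \in G ->
  P g *m row_mx 1%:M 0 = row_mx 1%:M 0 *m dadd_grepr P Q g.
Proof.
move=> Gg; rewrite mul_mx_row /= mul_row_block !mulmx0 mul0mx mulmx1 mul1mx.
by rewrite addr0 add0r.
Qed.

Lemma mod_inrP (P Q : rep) g : g \in G ->
  Q g *m row_mx 0 1%:M = row_mx 0 1%:M *m dadd_grepr P Q g.
Proof.
move=> Gg; rewrite mul_mx_row /= mul_row_block !mulmx0 !mul0mx mulmx1 mul1mx.
by rewrite !add0r.
Qed.

Definition mod_inl (P Q : rep) := @ModHom P (dadd_grepr P Q) _ (@mod_inlP P Q).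
Definition mod_inr (P Q : rep) := @ModHom Q (dadd_grepr P Q) _ (@mod_inrP P Q).

Lemma projective_dadd (P Q : rep) :
  projective P -> projective Q -> projective (dadd_grepr P Q).
Proof.
move=> pP pQ M N e f es.
have [l1 h1] := pP _ _ e (mod_comp (mod_inl P Q) f) es.
have [l2 h2] := pQ _ _ e (mod_comp (mod_inr P Q) f) es.
exists (mod_col l1 l2); rewrite /= mul_col_mx h1 h2 /= -mul_col_mx.
have -> : col_mx (row_mx 1%:M 0) (row_mx 0 1%:M)
  = 1%:M :> 'M[F]_(rdegree P + rdegree Q) by rewrite -block_mxEv -scalar_mx_block.
exact: mul1mx.
Qed.

(* Higman's criterion: a module is projective if and only if its identity is a
   relative trace, see [rel_trace_projective] and [projective_trace]. *)
Definition rel_trace (M N : rep) (t : 'M[F]_(rdegree M, rdegree N)) :=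
  \sum_(g in G) M g^-1%g *m t *m N g.

Lemma rel_traceP (M N : rep) (t : 'M[F]_(rdegree M, rdegree N)) g :
  g \in G -> M g *m rel_trace t = rel_trace t *m N g.
Proof.
move=> Gg; rewrite mulmx_sumr mulmx_suml (reindex_inj (mulIg g)) /=.
apply: eq_big => [h|h]; first by rewrite groupMr.
rewrite groupMr // => Gh; rewrite invMg !mulmxA -repr_mxM ?groupM ?groupV //.
by rewrite mulKVg -!mulmxA -repr_mxM.
Qed.

Definition mod_trace (M N : rep) (t : 'M[F]_(rdegree M, rdegree N)) :
  modhom M N := ModHom (rel_traceP t).

Lemma rel_traceM (M N A B : rep) (t : 'M[F]_(rdegree M, rdegree N))
    (f : modhom A M) (h : modhom N B) :
  mmx f *m rel_trace t *m mmx h = rel_trace (mmx f *m t *m mmx h).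
Proof.
rewrite mulmx_sumr mulmx_suml; apply: eq_bigr => g Gg.
by rewrite !mulmxA -(mmxP f) ?groupV // -!mulmxA (mmxP h).
Qed.

Lemma rel_trace_projective (P : rep) (t : 'M[F]_(rdegree P)) :
  @rel_trace P P t = 1%:M -> projective P.
Proof.
move=> t1 M N e f es.
exists (@mod_trace P M (t *m mmx f *m pinvmx (mmx e))) => /=.
have ef : mmx f = mmx (mod_id P) *m @rel_trace P P t *m mmx f.
  by rewrite t1 !mul1mx.
rewrite [RHS]ef rel_traceM /= mul1mx.
have := rel_traceM (t *m mmx f *m pinvmx (mmx e)) (mod_id P) e.
rewrite /= !mul1mx => ->; congr rel_trace.
by rewrite -mulmxA mulVpmx // mulmx1.
Qed.

Lemma tprodDl m1 n1 m2 n2 (A1 A2 : 'M[F]_(m1, n1)) (B : 'M[F]_(m2, n2)) :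
  tprod (A1 + A2) B = tprod A1 B + tprod A2 B.
Proof.
elim: m1 A1 A2 => [|m IHm] A1 A2 /=; first by rewrite addr0.
by rewrite !linearD /= IHm -trowbE linearD /= !trowbE add_col_mx.
Qed.

Lemma tprodDr m1 n1 m2 n2 (A : 'M[F]_(m1, n1)) (B1 B2 : 'M[F]_(m2, n2)) :
  tprod A (B1 + B2) = tprod A B1 + tprod A B2.
Proof.
elim: m1 A => [|m IHm] A /=; first by rewrite addr0.
by rewrite IHm linearD /= add_col_mx.
Qed.

Lemma tprod_suml (I : finType) (P : pred I) m1 n1 m2 n2
    (A : I -> 'M[F]_(m1, n1)) (B : 'M[F]_(m2, n2)) :
  tprod (\sum_(i | P i) A i) B = \sum_(i | P i) tprod (A i) B.
Proof.
apply: (big_morph (fun X => tprod X B)) => [X Y|]; first exact: tprodDl.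
by apply: (addIr (tprod 0 B)); rewrite -tprodDl !add0r.
Qed.

Lemma tprod_sumr (I : finType) (P : pred I) m1 n1 m2 n2
    (A : 'M[F]_(m1, n1)) (B : I -> 'M[F]_(m2, n2)) :
  tprod A (\sum_(i | P i) B i) = \sum_(i | P i) tprod A (B i).
Proof.
apply: (big_morph (fun X => tprod A X)) => [X Y|]; first exact: tprodDr.
by apply: (addIr (tprod A 0)); rewrite -tprodDr !add0r.
Qed.

Definition mod_tens (M N : rep) : rep := Representation (prod_repr M N).

Definition mod_reg : rep := Representation (regular_repr F G).

Lemma mod_tens_trace (M N : rep) (t : 'M[F]_(rdegree N)) :
  @rel_trace N N t = 1%:M ->
  @rel_trace (mod_tens M N) (mod_tens M N) (tprod 1%:M t) = 1%:M.
Proof.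
move=> t1; rewrite -tprod1 -t1 tprod_sumr; apply: eq_bigr => g Gg /=.
by rewrite -!tprodE mulmx1 -repr_mxM ?groupV // mulVg repr_mx1.
Qed.

Lemma mod_tens_tracel (M N : rep) (t : 'M[F]_(rdegree M)) :
  @rel_trace M M t = 1%:M ->
  @rel_trace (mod_tens M N) (mod_tens M N) (tprod t 1%:M) = 1%:M.
Proof.
move=> t1; rewrite -tprod1 -t1 tprod_suml; apply: eq_bigr => g Gg /=.
by rewrite -!tprodE mulmx1 -repr_mxM ?groupV // mulVg repr_mx1.
Qed.

Lemma mod_reg_trace : exists t, @rel_trace mod_reg mod_reg t = 1%:M.
Proof.
pose i1 := gring_index G 1%g; exists (delta_mx i1 i1).
have E g : g \in G -> regular_repr F G g^-1%g *m delta_mx i1 i1 *m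
    regular_repr F G g = delta_mx (gring_index G g) (gring_index G g).
  move=> Gg; rewrite -(mul_delta_mx (0 : 'I_1)) mulmxA -mulmxA -rowE rowK.
  rewrite gring_indexK // mul1g -colE -[RHS](mul_delta_mx (0 : 'I_1)).
  congr (_ *m _); apply/matrixP=> j k; rewrite !ord1 !mxE eqxx andbT /=.
  congr (nat_of_bool _)%:R; apply/idP/idP=> /eqP; last first.
    by move=> ->; rewrite gring_indexK // mulgV.
  move/(congr1 enum_val); rewrite !gring_indexK ?groupM ?groupV ?enum_valP //.
  move=> e; apply/eqP.
  by rewrite -[LHS]gring_valK -[enum_val j](mulgKV g) -e mul1g.
rewrite /rel_trace (eq_bigr _ E) /= (reindex_onto enum_val (gring_index G)) /=.
  rewrite (eq_bigl xpredT) => [|i]; last by rewrite enum_valP gring_valK eqxx.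
  under eq_bigr do rewrite gring_valK.
  apply/matrixP=> i j; rewrite summxE (bigD1 i) //= big1 => [|k ki].
    by rewrite !mxE eqxx addr0 eq_sym.
  by rewrite !mxE eq_sym (negbTE ki).
by move=> g Gg; rewrite gring_indexK.
Qed.

(* The augmentation [kG (x) M -> M], a surjection from a projective module. *)
Definition aug_mx n : 'M[F]_(gcard G * n, n) :=
  lsubmx (tprod (const_mx 1 : 'cV[F]_(gcard G)) (1%:M : 'M[F]_n)
            : 'M_(gcard G * n, n + 0)).

Lemma tprod_lsub m1 n1 m2 n2 p2 (A : 'M[F]_(m1, n1)) (B : 'cV[F]_n1)
    (C : 'M[F]_(m2, n2)) (D : 'M[F]_(n2, p2)) :
  tprod A C *m lsubmx (tprod B D : 'M_(n1 * n2, p2 + 0)) =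
  lsubmx (tprod (A *m B) (C *m D) : 'M_(m1 * m2, p2 + 0)).
Proof. by rewrite tprodE mulmx_lsub. Qed.

Lemma lsub_tprod m1 m2 n2 p2 (A : 'cV[F]_m1) (C : 'M[F]_(m2, n2))
    (D : 'M[F]_(n2, p2)) :
  lsubmx (tprod A C : 'M_(m1 * m2, n2 + 0)) *m D =
  lsubmx (tprod A (C *m D) : 'M_(m1 * m2, p2 + 0)).
Proof.
have e : tprod (1%:M : 'M[F]_1) D = block_mx D 0 0 0 :> 'M_(n2 + 0, p2 + 0).
  rewrite /= -[RHS]/(col_mx _ _); congr col_mx; last by apply/matrixP=> -[].
  rewrite !mxE /= scale1r; congr row_mx.
by rewrite -[A in RHS]mulmx1 tprodE e -[X in lsubmx (X *m _)]hsubmxK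
  mul_row_block !mulmx0 addr0 row_mxKl.
Qed.

Lemma aug_mxP (M : rep) g : g \in G ->
  mod_tens mod_reg M g *m aug_mx (rdegree M) = aug_mx (rdegree M) *m M g.
Proof.
move=> Gg; rewrite tprod_lsub lsub_tprod mulmx1 mul1mx.
suff -> : regular_repr F G g *m const_mx 1 = const_mx 1 :> 'cV_(gcard G).
  by [].
apply/matrixP=> i j; rewrite !mxE (bigD1 (gring_index G (enum_val i * g))) //= !mxE !eqxx big1.
  by rewrite addr0 mulr1.
by move=> k ki; rewrite !mxE (negbTE ki) mul0r.
Qed.

Definition mod_aug (M : rep) : modhom (mod_tens mod_reg M) M :=
  @ModHom (mod_tens mod_reg M) M _ (@aug_mxP M).

Lemma mod_aug_surj (M : rep) : mod_surj (mod_aug M).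
Proof.
apply/row_fullP; pose i1 := gring_index G 1%g.
exists (usubmx (tprod (delta_mx 0 i1 : 'rV[F]_(gcard G)) (1%:M : 'M_(rdegree M))
  : 'M_(rdegree M + 0, gcard G * rdegree M))).
have d1 : (delta_mx 0 i1 : 'rV[F]_(gcard G)) *m const_mx 1 = 1%:M :> 'M_1.
  apply/matrixP=> i j; rewrite !ord1 !mxE (bigD1 i1) //= !mxE !eqxx big1.
    by rewrite addr0 mulr1.
  by move=> k ki; rewrite !mxE (negbTE ki) mul0r.
rewrite mul_usub_mx.
have := tprod_lsub (delta_mx 0 i1 : 'rV[F]_(gcard G)) (const_mx 1 : 'cV[F]_(gcard G))
  (1%:M : 'M_(rdegree M)) (1%:M : 'M_(rdegree M)).
rewrite d1 mulmx1 tprod1 => /(congr1 (fun A : 'M_(rdegree M + 0, _) => usubmx A)).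
move=> ->; apply/matrixP=> i j; rewrite !mxE.
by congr (_%:R); rewrite -val_eqE.
Qed.

Lemma projective_trace (P : rep) :
  projective P -> exists t, @rel_trace P P t = 1%:M.
Proof.
move=> /(_ _ _ (mod_aug P) (mod_id P) (mod_aug_surj P)) [s sK].
have [t0 /(mod_tens_tracel P) t1] := mod_reg_trace.
exists (mmx s *m tprod t0 1%:M *m mmx (mod_aug P)).
have := @rel_traceM (mod_tens mod_reg P) (mod_tens mod_reg P) P P
  (tprod t0 1%:M) s (mod_aug P).
by rewrite t1 mulmx1 sK => <-.
Qed.

Lemma projective_tens (M P : rep) : projective P -> projective (mod_tens M P).
Proof.
by move=> /projective_trace [t /(mod_tens_trace M)/rel_trace_projective].
Qed.

Lemma mod_tenshP (V M N : rep) (f : modhom M N) g : g \in G ->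
  mod_tens V M g *m tprod 1%:M (mmx f) = tprod 1%:M (mmx f) *m mod_tens V N g.
Proof. by move=> Gg; rewrite -!tprodE mulmx1 mul1mx mmxP. Qed.

Definition mod_tensh (V M N : rep) (f : modhom M N) :=
  @ModHom (mod_tens V M) (mod_tens V N) _ (mod_tenshP V f).

(* The cosyzygy sequence [0 -> M -> kG (x) M -> (kG / k) (x) M -> 0], where [k]
   is embedded in [kG] as the span of the sum of all group elements. *)
Definition norm_row : 'rV[F]_(gcard G) := const_mx 1.

Lemma norm_rowP g : g \in G -> norm_row *m regular_repr F G g = norm_row.
Proof.
move=> Gg; apply/matrixP=> i j; rewrite !mxE.
have gj : (enum_val j * g^-1)%g \in G by rewrite groupM ?groupV ?enum_valP.
rewrite (bigD1 (gring_index G (enum_val j * g^-1))) //= !mxE gring_indexK //.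
rewrite mulgKV gring_valK !eqxx mulr1 big1 ?addr0 // => k kj.
rewrite !mxE eqxx /=; case: eqP => [e|_]; last by rewrite mulr0.
case/eqP: kj; rewrite e gring_indexK ?groupM ?enum_valP //.
by rewrite mulgK gring_valK.
Qed.

Lemma norm_module : mxmodule (regular_repr F G) <<norm_row>>%MS.
Proof.
apply/mxmoduleP=> g Gg.
by rewrite (eqmxMr _ (genmxE _)) norm_rowP // genmxE.
Qed.

Definition reg_mod_norm : rep := Representation (factmod_repr norm_module).

Definition cosyz (M : rep) : rep := mod_tens reg_mod_norm M.

Lemma trow_tprod n1 m2 n2 p2 q2 (A : 'rV[F]_n1) (B : 'M[F]_(m2, n2))
    (C : 'M[F]_(n1, p2)) (D : 'M[F]_(n2, q2)) :
  trow A B *m tprod C D = trow (A *m C) (B *m D).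
Proof.
have trowE n3 m3 p3 (X : 'rV[F]_n3) (Y : 'M[F]_(m3, p3)) :
    trow X Y = usubmx (tprod X Y : 'M_(m3 + 0, n3 * p3)).
  suff {1}-> : X = usubmx (X : 'M_(1 + 0, n3)) by rewrite /= col_mxKu.
  by apply/matrixP=> i j; rewrite !mxE; congr (X _ _); apply/val_inj.
rewrite !trowE mul_usub_mx.
exact: (congr1 (@usubmx F m2 0 (p2 * q2)) (esym (tprodE A C B D))).
Qed.

Lemma mul_trow n1 m2 n2 p2 (A : 'rV[F]_n1) (B : 'M[F]_(m2, n2))
    (D : 'M[F]_(n2, p2)) : trow A (B *m D) = B *m trow A D.
Proof.
elim: n1 A => [|n1 IHn] A /=; first by rewrite mulmx0.
by rewrite IHn mul_mx_row scalemxAr.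
Qed.

Lemma cosyz_injP (M : rep) g : g \in G ->
  M g *m trow norm_row 1%:M = trow norm_row 1%:M *m mod_tens mod_reg M g.
Proof.
by move=> Gg; rewrite trow_tprod norm_rowP // mul1mx -mul_trow mulmx1.
Qed.

Definition cosyz_inj (M : rep) : modhom M (mod_tens mod_reg M) :=
  @ModHom M (mod_tens mod_reg M) _ (@cosyz_injP M).

Lemma cosyz_projP (M : rep) g : g \in G ->
  mod_tens mod_reg M g *m tprod (in_factmod <<norm_row>>%MS 1%:M) 1%:M =
  tprod (in_factmod <<norm_row>>%MS 1%:M) 1%:M *m cosyz M g.
Proof.
move=> Gg; rewrite /= -!tprodE mulmx1 mul1mx -in_factmodE.
by rewrite -in_factmodJ // mul1mx.
Qed.

Definition cosyz_proj (M : rep) : modhom (mod_tens mod_reg M) (cosyz M) :=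
  @ModHom (mod_tens mod_reg M) (cosyz M) _ (@cosyz_projP M).

Lemma cosyz_exact (M : rep) : short_exact (cosyz_inj M) (cosyz_proj M).
Proof.
set n := rdegree M; set P := in_factmod <<norm_row>>%MS 1%:M.
have nzP : norm_row *m P = 0.
  by apply/eqP; rewrite -in_factmodE in_factmod_eq0 genmxE.
have nz0 : norm_row != 0.
  apply/eqP=> /rowP/(_ (gring_index G 1%g)); rewrite !mxE.
  by move/eqP; rewrite oner_eq0.
have surj : mod_surj (cosyz_proj M).
  apply/row_fullP; exists (tprod (val_factmod 1%:M) 1%:M).
  rewrite /= -tprodE mulmx1 -/P -in_factmodE val_factmodK.
  exact: tprod1.
have inj : row_free (mmx (cosyz_inj M)).
  apply: inj_row_free => v /=; rewrite -mul_trow mulmx1.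
  rewrite /norm_row; case: (gcard G) (cardG_gt0 G : (0 < gcard G)%N) => // m _ /=.
  rewrite -[RHS]row_mx0 => /eq_row_mx[+ _].
  by rewrite mxE mxE scale1r.
have sub : (mmx (cosyz_inj M) <= kermx (mmx (cosyz_proj M)))%MS.
  by apply/sub_kermxP; rewrite /= trow_tprod nzP trow0.
split=> //; apply/eqmxP; rewrite -(geq_leqif (mxrank_leqif_eq sub)).
rewrite mxrank_ker (eqP surj) (eqP inj) /=.
rewrite -mulnBl mxrank_coker mxrank_gen rank_rV nz0.
by rewrite subKn ?mul1n ?cardG_gt0.
Qed.

Lemma stable_refl (M N : rep) (f : modhom M N) : stable_eq f f.
Proof.
have z0 g : g \in G -> @grepr0 F gT G g *m 0 = 0 *m N g.
  by move=> _; rewrite mulmx0 mul0mx.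
have z1 g : g \in G -> M g *m 0 = 0 *m @grepr0 F gT G g.
  by move=> _; rewrite mulmx0 mul0mx.
exists (@grepr0 F gT G), (ModHom z1), (ModHom z0); split; last first.
  by rewrite subrr /= mulmx0.
move=> A B e h _.
have z2 g : g \in G -> @grepr0 F gT G g *m 0 = 0 *m A g.
  by move=> _; rewrite mulmx0 mul0mx.
exists (ModHom z2); rewrite /= mul0mx.
by apply/matrixP=> -[].
Qed.

Lemma stable_sym (M N : rep) (f g : modhom M N) :
  stable_eq f g -> stable_eq g f.
Proof.
case=> P [a [b [pP e]]]; exists P, (mod_opp a), b; split=> //=.
by rewrite mulNmx -e opprB.
Qed.

Lemma stable_trans (M N : rep) (f g h : modhom M N) :
  stable_eq f g -> stable_eq g h -> stable_eq f h.
Proof.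
case=> P [a [b [pP e]]] [Q [c [d [pQ e']]]].
exists (dadd_grepr P Q), (mod_row a c), (mod_col b d).
split; first exact: projective_dadd.
by rewrite /= mul_row_col -e -e' addrA subrK.
Qed.

Lemma stable_comp (M N P : rep) (f f' : modhom M N) (g g' : modhom N P) :
  stable_eq f f' -> stable_eq g g' ->
  stable_eq (mod_comp f g) (mod_comp f' g').
Proof.
case=> A [a [b [pA e]]] [B [c [d [pB e']]]].
apply: (@stable_trans _ _ _ (mod_comp f' g)).
  exists A, a, (mod_comp b g); split=> //=.
  by rewrite mulmxA -e mulmxBl.
exists B, (mod_comp f' c), d; split=> //=.
by rewrite -mulmxA -e' mulmxBr.
Qed.

Lemma stable_of_eq (M N : rep) (f g : modhom M N) :
  mmx f = mmx g -> stable_eq f g.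
Proof.
by have [P [a [b [pP e]]]] := stable_refl f => fg; exists P, a, b; rewrite -fg.
Qed.

Lemma stable_comp1 (M N : rep) (f : modhom M N) :
  stable_eq (mod_comp (mod_id M) f) f.
Proof. by apply: stable_of_eq; exact: mul1mx. Qed.

Lemma stable_comp2 (M N : rep) (f : modhom M N) :
  stable_eq (mod_comp f (mod_id N)) f.
Proof. by apply: stable_of_eq; exact: mulmx1. Qed.

Lemma stable_compA (M N P Q : rep) (f : modhom M N) (g : modhom N P)
    (h : modhom P Q) :
  stable_eq (mod_comp f (mod_comp g h)) (mod_comp (mod_comp f g) h).
Proof. by apply: stable_of_eq; exact: mulmxA. Qed.

Definition stable_cat : category := {|
  ob := rep;
  hom := modhom;
  heq := stable_eq;
  idh := mod_id;
  comp := mod_comp;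
  heq_refl := stable_refl;
  heq_sym := stable_sym;
  heq_trans := stable_trans;
  comp_heq := stable_comp;
  comp1h := stable_comp1;
  comph1 := stable_comp2;
  comphA := stable_compA
|}.

Lemma cosyz_heq (M N : rep) (f g : modhom M N) :
  stable_eq f g ->
  stable_eq (mod_tensh reg_mod_norm f) (mod_tensh reg_mod_norm g).
Proof.
case=> P [a [b [pP e]]].
exists (cosyz P), (mod_tensh _ a), (mod_tensh _ b).
split; first exact: projective_tens.
rewrite /= -tprodE -e mulmx1; apply/eqP.
by rewrite subr_eq -tprodDr subrK.
Qed.

Lemma cosyz_id (M : rep) :
  stable_eq (mod_tensh reg_mod_norm (mod_id M)) (mod_id (cosyz M)).
Proof. by apply: stable_of_eq; exact: tprod1. Qed.

Lemma cosyz_comp (M N P : rep) (f : modhom M N) (g : modhom N P) :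
  stable_eq (mod_tensh reg_mod_norm (mod_comp f g))
    (mod_comp (mod_tensh reg_mod_norm f) (mod_tensh reg_mod_norm g)).
Proof. by apply: stable_of_eq; rewrite /= -tprodE mulmx1. Qed.

Definition stable_shift_cat : shift_category := {|
  scat := stable_cat;
  shift := cosyz : stable_cat -> stable_cat;
  shifth M N f := mod_tensh reg_mod_norm f;
  shift_heq := cosyz_heq;
  shift_id := cosyz_id;
  shift_comp := cosyz_comp
|}.

(* The triangle of a short exact sequence [0 -> A -> B -> C -> 0]: the third
   morphism is induced by a map of this sequence to the cosyzygy sequence of
   [A] that is the identity on [A]. *)
Definition exact_triangle (X : triangle stable_shift_cat) :=
  short_exact (tri12 X) (tri23 X) /\
  exists2 u : modhom (tri2 X) (mod_tens mod_reg (tri1 X)),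
    mmx (tri12 X) *m mmx u = mmx (cosyz_inj (tri1 X)) &
    mmx (tri23 X) *m mmx (tri31 X) = mmx u *m mmx (cosyz_proj (tri1 X)).

Definition stab : ttcat := {|
  ttri := {|
    tcat := stable_shift_cat;
    dist Y := exists2 X : triangle stable_shift_cat,
      exact_triangle X & triangle_iso X Y
  |};
  tens := mod_tens
|}.

End StableCategory.

(* Main.v *)
From mathcomp Require Import all_boot all_order all_algebra all_fingroup.
From mathcomp Require Import all_solvable all_character.
From mathcomp Require Import all_classical all_reals topology.
From mathcomp Require Import freeg.
Require Import Defs.
From Corelib Require Import -(notations) Setoid Morphisms.

Set Implicit Arguments.
Unset Strict Implicit.
Unset Printing Implicit Defensive.

Import Order.TTheory GRing.Theory Num.Theory.
Local Open Scope classical_set_scope.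
Local Open Scope ring_scope.

(** Let q = p ^ n, let x generate G, let N be the sum of the elements of G, and
    write k also for the trivial module.  Two facts about the stable category
    K of kG carry the proof.

    The projective modules form the only prime of K ([spc_pointE]).  Indeed a
    module M that is not projective generates K as a thick subcategory
    ([thick_nonprojective_full]).  Splitting off free summands, one may assume
    that N acts as zero on M ([norm_reduction]); then k is a direct summand of
    the cone of x - 1 : M -> M ([norm0_thick_triv]), and k generates
    everything, as all modules of a p-group have a filtration with quotients
    k.  A prime ideal with a nonprojective element would therefore not be
    proper; and if A (x) B is projective but A is not, the thick subcategory of
    the C with C (x) B projective contains k, so that B is projective.  Hence
    K_(l) is K for l >= 0 and consists of zero objects for l < 0 ([dim_leP]).
    For l <> 0 the quotient K_(l) / K_(l-1) is zero, and for l = 0 only zero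
    objects are divided out.

    The Grothendieck group of K is Z/q, through the dimension mod q.  The
    class of M is its dimension times the class of k, by the filtrations
    above, and q times this class is the class of kG, that is 0
    ([additive_degree]).  Conversely, projective modules have dimensions
    divisible by q ([projective_degree]), so that the dimension mod q depends
    on the stable isomorphism class only ([stable_iso_degree]).  To pass to
    the idempotent completion of the quotient, words in morphisms and formal
    inverses are evaluated in K ([verdier_eval]), where idempotents split by
    Fitting's lemma ([stable_idem_split]).  An object of the completion thus
    has a dimension mod q, and what remains is its additivity on a direct
    factor of a distinguished triangle: by the five lemma the third term of
    such a factor is stably isomorphic to the cone of its first morphism
    ([retract_degree]).

    As K_(0) = K_(1) = K, the map iota is injective in degree 0, and nothing is
    divided out in the Chow group.

    The computations rest on Higman's criterion: a homomorphism factors through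
    a projective module if and only if it is a relative trace, that is a sum
    over G of conjugates of a linear map ([null], [stable_nullP]).  Such maps
    lift along surjections and extend along injections by explicit formulas,
    which turns exactness statements into identities of matrices. *)

(** * Rewriting morphisms *)

#[global] Instance heq_equivalence (C : category) (A B : C) :
  Equivalence (@heq C A B).
Proof.
split; [exact: heq_refl | exact: heq_sym | exact: heq_trans].
Qed.

#[global] Instance comp_proper (C : category) (A B D : C) :
  Proper (respectful (@heq C A B) (respectful (@heq C B D) (@heq C A D)))
    (@comp C A B D).
Proof. by move=> f f' ff' g g' gg'; exact: comp_heq. Qed.

#[global] Instance shifth_proper (T : shift_category) (A B : T) :
  Proper (respectful (@heq T A B) (@heq T (shift A) (shift B)))
    (@shifth T A B).
Proof. by move=> f f'; exact: shift_heq. Qed.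

#[global] Hint Resolve heq_refl : core.

Section Isomorphisms.
Variable C : category.
Implicit Types A B D : C.

Lemma is_iso_id A : is_iso (idh A).
Proof. by exists (idh A); split; exact: comp1h. Qed.

Lemma is_iso_comp A B D (f : hom A B) (g : hom B D) :
  is_iso f -> is_iso g -> is_iso (f ;; g).
Proof.
case=> f' [ff' f'f] [g' [gg' g'g]]; exists (g' ;; f'); split.
  by rewrite comphA -(comphA f) gg' comph1.
by rewrite comphA -(comphA g') f'f comph1.
Qed.

Lemma is_iso_heq A B (f g : hom A B) : f ~= g -> is_iso f -> is_iso g.
Proof.
by move=> fg [f' [ff' f'f]]; exists f'; split; [rewrite -fg | rewrite -fg].
Qed.

Lemma inverse_unique A B (f : hom A B) (g g' : hom B A) :
  inverse_of f g -> inverse_of f g' -> g ~= g'.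
Proof.
move=> [fg gf] [fg' g'f].
by rewrite -(comph1 g) -fg' comphA gf comp1h.
Qed.

End Isomorphisms.

Lemma is_iso_shift (T : shift_category) (A B : T) (f : hom A B) :
  is_iso f -> is_iso (shifth f).
Proof.
case=> g [fg gf]; exists (shifth g).
by split; rewrite -shift_comp -shift_id; [rewrite fg | rewrite gf].
Qed.

Lemma triangle_iso_retract (T : shift_category) (X Y : triangle T) :
  triangle_iso X Y -> triangle_retract Y X /\ triangle_retract X Y.
Proof.
case=> m [[n1 [mn1 nm1]] [n2 [mn2 nm2]] [n3 [mn3 nm3]]].
have e12 : tri12 Y ;; n2 ~= n1 ;; tri12 X.
  by rewrite -(comp1h (tri12 Y)) -nm1 -(comphA n1) -tmap12 -!comphA mn2 comph1.
have e23 : tri23 Y ;; n3 ~= n2 ;; tri23 X.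
  by rewrite -(comp1h (tri23 Y)) -nm2 -(comphA n2) -tmap23 -!comphA mn3 comph1.
have e31 : tri31 Y ;; shifth n1 ~= n3 ;; tri31 X.
  rewrite -(comp1h (tri31 Y)) -nm3 -(comphA n3) -tmap31 -!comphA -shift_comp.
  by rewrite mn1 shift_id comph1.
by split; [exists (TriangleMap e12 e23 e31), m | exists m,
  (TriangleMap e12 e23 e31)].
Qed.

(** * Homomorphisms that factor through projective modules *)

Section StableCalculus.
Variables (F : fieldType) (gT : finGroupType) (G : {group gT}).
Local Notation rep := (representation F G).
Local Notation K := (stab F G).
Implicit Types M N P A B C W : rep.

(** By Higman's criterion these are the homomorphisms that vanish in the
    stable category; the existence of t is easier to manipulate than a
    factorization through a projective module. *)
Definition null M N (a : 'M[F]_(rdegree M, rdegree N)) :=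
  exists t, a = @rel_trace F gT G M N t.

Lemma nullMl L M N (f : modhom L M) (a : 'M[F]_(rdegree M, rdegree N)) :
  @null M N a -> @null L N (mmx f *m a).
Proof.
case=> t ->; exists (mmx f *m t).
by have := rel_traceM t f (mod_id N); rewrite /= !mulmx1.
Qed.

Lemma nullMr M N P (a : 'M[F]_(rdegree M, rdegree N)) (f : modhom N P) :
  @null M N a -> @null M P (a *m mmx f).
Proof.
case=> t ->; exists (t *m mmx f).
by have := rel_traceM t (mod_id M) f; rewrite /= !mul1mx.
Qed.

Lemma null0 M N : @null M N 0.
Proof.
by exists 0; rewrite /rel_trace big1 // => g _; rewrite mulmx0 mul0mx.
Qed.

Lemma nullD M N (a b : 'M[F]_(rdegree M, rdegree N)) :
  @null M N a -> @null M N b -> @null M N (a + b).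
Proof.
case=> t -> [s ->]; exists (t + s); rewrite /rel_trace -big_split.
by apply: eq_bigr => g _; rewrite mulmxDr mulmxDl.
Qed.

Lemma nullN M N (a : 'M[F]_(rdegree M, rdegree N)) :
  @null M N a -> @null M N (- a).
Proof.
case=> t ->; exists (- t); rewrite /rel_trace -sumrN.
by apply: eq_bigr => g _; rewrite mulmxN mulNmx.
Qed.

Lemma nullB M N (a b : 'M[F]_(rdegree M, rdegree N)) :
  @null M N a -> @null M N b -> @null M N (a - b).
Proof. by move=> na nb; apply: nullD => //; apply: nullN. Qed.

Lemma mod_reg_tens_projective M : projective (mod_tens (mod_reg F G) M).
Proof.
have [t /(mod_tens_tracel M)] := @mod_reg_trace F gT G.
exact: rel_trace_projective.
Qed.

Lemma null_projective M P N (a : modhom M P) (b : modhom P N) :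
  projective P -> @null M N (mmx a *m mmx b).
Proof.
move=> /projective_trace[t t1].
by exists (mmx a *m t *m mmx b); rewrite -rel_traceM t1 mulmx1.
Qed.

Lemma projective_null M : projective M <-> @null M M 1%:M.
Proof.
split=> [pM|[t t1]]; last exact: rel_trace_projective (esym t1).
by have := null_projective (mod_id M) (mod_id M) pM; rewrite mulmx1.
Qed.

(** A linear retraction of f composed with t is a matrix whose relative trace
    extends that of t; projective modules are injective for this reason. *)
Lemma null_extend A B W (f : modhom A B) (a : 'M_(rdegree A, rdegree W)) :
  row_free (mmx f) -> @null A W a ->
  exists2 b : modhom B W, mmx f *m mmx b = a & @null B W (mmx b).
Proof.
move=> /row_freeP[s fs] [t ->]; exists (mod_trace (s *m t)); last first.
  by exists (s *m t).
have := rel_traceM (s *m t) f (mod_id W).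
by rewrite /= mulmxA fs !mulmx1 mul1mx.
Qed.

Lemma null_lift W B C (g : modhom B C) (a : 'M_(rdegree W, rdegree C)) :
  mod_surj g -> @null W C a ->
  exists2 b : modhom W B, mmx b *m mmx g = a & @null W B (mmx b).
Proof.
move=> /row_fullP[s sg] [t ->]; exists (mod_trace (t *m s)); last first.
  by exists (t *m s).
have := rel_traceM (t *m s) (mod_id W) g.
by rewrite /= -!mulmxA sg !mulmx1 !mul1mx.
Qed.

Lemma stable_nullP M N (f g : modhom M N) :
  stable_eq f g <-> @null M N (mmx f - mmx g).
Proof.
split=> [[P [a [b [pP ->]]]]|n]; first exact: null_projective.
have [ifree _ _] := cosyz_exact M.
have [b ib _] := null_extend ifree n.
exists (mod_tens (mod_reg F G) M), (cosyz_inj M), b.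
by split; [exact: mod_reg_tens_projective | rewrite ib].
Qed.

End StableCalculus.

Arguments null {F gT G} M N a.

(** * Triangles on which Hom functors are exact *)

Section HomExact.
Variables (F : fieldType) (gT : finGroupType) (G : {group gT}).
Local Notation rep := (representation F G).
Local Notation K := (stab F G).

Definition mod_zero (M N : K) : hom M N :=
  ModHom (fun g Gg => etrans (mulmx0 _ (M g)) (esym (mul0mx _ (N g)))).

Lemma mod_addP (M N : rep) (f h : modhom M N) g : g \in G ->
  M g *m (mmx f + mmx h) = (mmx f + mmx h) *m N g.
Proof. by move=> Gg; rewrite mulmxDr mulmxDl !mmxP. Qed.

Definition mod_add (M N : K) (f h : hom M N) : hom M N := ModHom (mod_addP f h).

Definition mod_sub (M N : K) (f h : hom M N) : hom M N := mod_add f (mod_opp h).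

Lemma heq0P (M N : K) (f : hom M N) : f ~= mod_zero M N <-> null M N (mmx f).
Proof.
by split=> [/stable_nullP|n]; [|apply/stable_nullP]; rewrite /= subr0.
Qed.

Lemma heq_subP (M N : K) (f g : hom M N) :
  f ~= g <-> mod_sub f g ~= mod_zero M N.
Proof. by rewrite heq0P; exact: stable_nullP. Qed.

#[global] Instance mod_add_proper (M N : K) :
  Proper (respectful (@heq K M N) (respectful (@heq K M N) (@heq K M N)))
    (@mod_add M N).
Proof.
move=> f f' /stable_nullP ff g g' /stable_nullP gg; apply/stable_nullP.
by rewrite /= opprD addrACA; exact: nullD.
Qed.

#[global] Instance mod_sub_proper (M N : K) :
  Proper (respectful (@heq K M N) (respectful (@heq K M N) (@heq K M N)))
    (@mod_sub M N).
Proof.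
move=> f f' /stable_nullP ff g g' /stable_nullP gg; apply/stable_nullP.
by rewrite /= opprD addrACA -opprD; exact: nullB.
Qed.

Lemma mod_subrr (M N : K) (f : hom M N) : mod_sub f f ~= mod_zero M N.
Proof. by apply: stable_of_eq; rewrite /= subrr. Qed.

Lemma shift_zero (M N : K) : shifth (mod_zero M N) ~= mod_zero _ _.
Proof.
apply: stable_of_eq => /=; apply: (addrI (tprod 1%:M 0)).
by rewrite -tprodDr !addr0.
Qed.

Lemma mod_comp0 (L M N : K) (f : hom L M) : f ;; mod_zero M N ~= mod_zero L N.
Proof. by apply: stable_of_eq; rewrite /= mulmx0. Qed.

Lemma mod_0comp (L M N : K) (f : hom M N) : mod_zero L M ;; f ~= mod_zero L N.
Proof. by apply: stable_of_eq; rewrite /= mul0mx. Qed.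

Lemma mod_sub_comp (L M N : K) (f g : hom L M) (h : hom M N) :
  mod_sub f g ;; h ~= mod_sub (f ;; h) (g ;; h).
Proof. by apply: stable_of_eq; rewrite /= mulmxBl. Qed.

Lemma mod_add_comp (L M N : K) (f g : hom L M) (h : hom M N) :
  mod_add f g ;; h ~= mod_add (f ;; h) (g ;; h).
Proof. by apply: stable_of_eq; rewrite /= mulmxDl. Qed.

Lemma projective_heq0 (M : K) : projective M <-> idh M ~= mod_zero M M.
Proof. by rewrite heq0P; exact: projective_null. Qed.

Lemma projective_from (M N : K) (f : hom M N) :
  projective M -> f ~= mod_zero M N.
Proof. by move=> /projective_heq0 M0; rewrite -(comp1h f) M0 mod_0comp. Qed.

Lemma projective_to (M N : K) (f : hom M N) :
  projective N -> f ~= mod_zero M N.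
Proof. by move=> /projective_heq0 N0; rewrite -(comph1 f) N0 mod_comp0. Qed.

Lemma projective_is_zero (M : K) : is_zero M <-> projective M.
Proof.
split=> [[/(_ M)[f fP] _]|pM].
  by apply/projective_heq0; rewrite (fP (idh M)) -(fP (mod_zero M M)).
by split=> N; exists (mod_zero _ _) => g; [exact: projective_from | exact:
  projective_to].
Qed.

(** The identity of M factors through N, hence is stably zero. *)
Lemma projective_retract (M N : K) (s : hom M N) (r : hom N M) :
  s ;; r ~= idh M -> projective N -> projective M.
Proof.
move=> sr /(projective_to s) s0; apply/projective_heq0.
by rewrite -sr s0 mod_0comp.
Qed.

(** The part of the axioms of a distinguished triangle that survives in its
    direct factors: consecutive composites vanish and each Hom(W, -) is exact
    at the second and third terms and at the suspension of the first. *)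
Record hom_exact (X : triangle K) : Prop := HomExact {
  hom_exact12 : tri12 X ;; tri23 X ~= mod_zero _ _;
  hom_exact23 : tri23 X ;; tri31 X ~= mod_zero _ _;
  hom_exact31 : tri31 X ;; shifth (tri12 X) ~= mod_zero _ _;
  hom_exact_lift2 : forall (W : K) (w : hom W (tri2 X)),
    w ;; tri23 X ~= mod_zero _ _ -> exists v, v ;; tri12 X ~= w;
  hom_exact_lift3 : forall (W : K) (w : hom W (tri3 X)),
    w ;; tri31 X ~= mod_zero _ _ -> exists v, v ;; tri23 X ~= w;
  hom_exact_lift1 : forall (W : K) (w : hom W (shift (tri1 X))),
    w ;; shifth (tri12 X) ~= mod_zero _ _ -> exists v, v ;; tri31 X ~= w
}.

Lemma hom_exact_retract (X Y : triangle K) :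
  triangle_retract Y X -> hom_exact X -> hom_exact Y.
Proof.
case=> s [r [sr1 sr2 sr3]] [X12 X23 X31 l2 l3 l1].
have sr1' : shifth (tmap1 s) ;; shifth (tmap1 r) ~= idh _.
  by rewrite -shift_comp sr1 shift_id.
have sr2' : shifth (tmap2 s) ;; shifth (tmap2 r) ~= idh _.
  by rewrite -shift_comp sr2 shift_id.
have s12' : shifth (tri12 Y) ;; shifth (tmap2 s) ~=
    shifth (tmap1 s) ;; shifth (tri12 X) by rewrite -!shift_comp (tmap12 s).
have r12' : shifth (tri12 X) ;; shifth (tmap2 r) ~=
    shifth (tmap1 r) ;; shifth (tri12 Y) by rewrite -!shift_comp (tmap12 r).
split.
- rewrite -(comph1 (tri23 Y)) -sr3 !comphA -(comphA (tri12 Y)) (tmap23 s).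
  by rewrite comphA (tmap12 s) -(comphA (tmap1 s)) X12 mod_comp0 mod_0comp.
- rewrite -(comph1 (tri31 Y)) -sr1' !comphA -(comphA (tri23 Y)) (tmap31 s).
  by rewrite comphA (tmap23 s) -(comphA (tmap2 s)) X23 mod_comp0 mod_0comp.
- rewrite -(comph1 (shifth _)) -sr2' !comphA -(comphA (tri31 Y)) s12'.
  by rewrite comphA (tmap31 s) -(comphA (tmap3 s)) X31 mod_comp0 mod_0comp.
- move=> W w w0; have [|v vE] := l2 W (w ;; tmap2 s).
    by rewrite -comphA -(tmap23 s) comphA w0 mod_0comp.
  exists (v ;; tmap1 r).
  by rewrite -comphA -(tmap12 r) comphA vE -comphA sr2 comph1.
- move=> W w w0; have [|v vE] := l3 W (w ;; tmap3 s).
    by rewrite -comphA -(tmap31 s) comphA w0 mod_0comp.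
  exists (v ;; tmap2 r).
  by rewrite -comphA -(tmap23 r) comphA vE -comphA sr3 comph1.
- move=> W w w0; have [|v vE] := l1 W (w ;; shifth (tmap1 s)).
    by rewrite -comphA -s12' comphA w0 mod_0comp.
  exists (v ;; tmap3 r).
  by rewrite -comphA -(tmap31 r) comphA vE -comphA sr1' comph1.
Qed.

Section ShortExact.
Variables (A B C : rep) (f : modhom A B) (g : modhom B C).
Hypothesis fg : short_exact f g.

Lemma short_exact_comp0 : mmx f *m mmx g = 0.
Proof. by case: fg => _ _ e; apply/sub_kermxP; rewrite e. Qed.

Lemma short_exact_injK m (a b : 'M_(m, rdegree A)) :
  a *m mmx f = b *m mmx f -> a = b.
Proof. by case: fg => ff _ _; exact: row_free_inj. Qed.

Lemma short_exact_surjK m (a b : 'M_(rdegree C, m)) :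
  mmx g *m a = mmx g *m b -> a = b.
Proof.
case: fg => _ /row_fullP[s sg] _ e.
by rewrite -[a]mul1mx -[b]mul1mx -sg -!mulmxA e.
Qed.

Lemma short_exact_lift m (a : 'M_(m, rdegree B)) :
  a *m mmx g = 0 -> exists b, a = b *m mmx f.
Proof.
move=> /sub_kermxP; case: fg => _ _ <- /submxP[b ->]; by exists b.
Qed.

(** The lift through the kernel is unique, which makes it equivariant. *)
Lemma short_exact_lift_hom (W : rep) (a : modhom W B) :
  mmx a *m mmx g = 0 -> exists b : modhom W A, mmx a = mmx b *m mmx f.
Proof.
move=> /short_exact_lift[b ab].
have bP s : s \in G -> W s *m b = b *m A s.
  move=> Gs; apply: short_exact_injK.
  by rewrite -!mulmxA -ab mmxP // mmxP // mulmxA -ab.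
by exists (ModHom bP).
Qed.

(** The universal property of the cokernel; a linear section s of g gives the
    factorization s a, whose equivariance follows from the surjectivity of g.
    *)
Lemma short_exact_factor_hom (W : rep) (a : modhom B W) :
  mmx f *m mmx a = 0 -> exists b : modhom C W, mmx a = mmx g *m mmx b.
Proof.
case: fg => _ /row_fullP[s sg] e fa0.
have ab : mmx a = mmx g *m (s *m mmx a).
  apply/eqP; rewrite -subr_eq0 mulmxA -{1}[mmx a]mul1mx -mulmxBl.
  have [|b ->] := @short_exact_lift _ (1%:M - mmx g *m s).
    by rewrite mulmxBl mul1mx -mulmxA sg mulmx1 subrr.
  by rewrite -mulmxA fa0 mulmx0.
have bP h : h \in G -> C h *m (s *m mmx a) = (s *m mmx a) *m W h.
  move=> Gh; apply: short_exact_surjK.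
  by rewrite [LHS]mulmxA -mmxP // -[LHS]mulmxA -ab mmxP // [in LHS]ab !mulmxA.
by exists (ModHom bP).
Qed.

Lemma short_exact_degree : rdegree B = (rdegree A + rdegree C)%N.
Proof.
case: fg => /eqP fA /eqP gC e.
by have := mxrank_ker (mmx g); rewrite -e fA gC => ->;
  rewrite subnK // -gC rank_leq_row.
Qed.

End ShortExact.
End HomExact.

(** * Long exact sequences *)

Section ExactTriangles.
Variables (F : fieldType) (gT : finGroupType) (G : {group gT}).
Local Notation rep := (representation F G).
Local Notation K := (stab F G).
Local Notation hull M := (mod_tens (mod_reg F G) M).

(** The module kG (x) N is projective and contains N; as projective modules
    are also injective, it plays the role of an injective hull of N
    throughout. *)
Lemma hull_null_from (M N P : rep) (a : modhom M (hull N)) (b : modhom (hull N)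
  P) :
  null M P (mmx a *m mmx b).
Proof. by apply: null_projective; exact: mod_reg_tens_projective. Qed.

Lemma cosyz_inj_natural (M N : rep) (f : modhom M N) :
  mmx (cosyz_inj M) *m mmx (mod_tensh (mod_reg F G) f) =
  mmx f *m mmx (cosyz_inj N).
Proof. by rewrite /= trow_tprod mulmx1 mul1mx -mul_trow mulmx1. Qed.

Lemma cosyz_proj_natural (M N : rep) (f : modhom M N) :
  mmx (cosyz_proj M) *m mmx (mod_tensh (reg_mod_norm F G) f) =
  mmx (mod_tensh (mod_reg F G) f) *m mmx (cosyz_proj N).
Proof. by rewrite /= -!tprodE !mulmx1 !mul1mx. Qed.

(** If the suspension of f lifts to the projective module kG (x) N by t, then
    1 (x) f minus the composite of the projection with t takes values in N,
    and so extends f to kG (x) M. *)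
Lemma shift_faithful (M N : K) (f : hom M N) :
  shifth f ~= mod_zero _ _ -> f ~= mod_zero _ _.
Proof.
move=> /heq0P; have [iM pM eM] := cosyz_exact M.
have exN := cosyz_exact N; have [iN pN eN] := exN.
case/(null_lift pN)=> t tE _.
pose d := @mod_sub F gT G (hull M) (hull N) (mod_tensh (mod_reg F G) f)
  (mod_comp (cosyz_proj M) t).
have [|v vE] := short_exact_lift_hom exN (a := d).
  by rewrite mulmxBl -cosyz_proj_natural -[X in _ - X]mulmxA tE subrr.
apply/heq0P; suff -> : mmx f = mmx (cosyz_inj M) *m mmx v.
  exact: hull_null_from.
apply: (short_exact_injK exN); rewrite -mulmxA -vE mulmxBr.
rewrite cosyz_inj_natural [X in _ - X]mulmxA.
by rewrite (short_exact_comp0 (cosyz_exact M)) mul0mx subr0.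
Qed.

(** Let u : B -> kG (x) A be the map that defines h. Then B is the fibre
    product of C and kG (x) A over the suspension of A, which gives exactness
    at C. The lift at the suspension of A is built from linear sections of
    surjections, whose failure to be equivariant takes values in A and
    cancels. *)
Lemma exact_triangle_hom_exact (X : triangle K) :
  exact_triangle X -> hom_exact X.
Proof.
case: X => A B C f g h /= [/= ex [u fu gh]]; rewrite /= in u fu gh.
have exA := cosyz_exact A; have exB := cosyz_exact B.
(* The maps g and u are jointly injective. *)
have joint m (a : 'M_(m, rdegree B)) : a *m mmx g = 0 -> a *m mmx u = 0 ->
  a = 0.
  move=> /(short_exact_lift ex)[z ->]; rewrite -mulmxA fu => z0.
  suff -> : z = 0 by rewrite mul0mx.
  by apply: (short_exact_injK exA); rewrite z0 mul0mx.
split=> /=.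
- by apply/heq0P; rewrite /= (short_exact_comp0 ex); exact: null0.
- by apply/heq0P; rewrite /= gh; exact: (hull_null_from u (cosyz_proj A)).
- pose uf : modhom B (hull B) := mod_comp u (mod_tensh _ f).
  have [|w wE] := short_exact_factor_hom ex (a :=
    @mod_sub F gT G B (hull B) uf (cosyz_inj B)).
    rewrite mulmxBr mulmxA fu [X in X - _]cosyz_inj_natural.
    by rewrite subrr.
  apply/heq0P; suff -> : mmx (h ;; shifth f) = mmx w *m mmx (cosyz_proj B).
    exact: (hull_null_from w (cosyz_proj B)).
  apply: (short_exact_surjK ex); rewrite [LHS]mulmxA gh -[LHS]mulmxA.
  rewrite [X in _ *m X = _]cosyz_proj_natural mulmxA.
  rewrite [RHS]mulmxA -wE mulmxBl (short_exact_comp0 exB) subr0.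
  by [].
- move=> W w /heq0P; have [_ gs _] := ex; case/(null_lift gs)=> v vE vn.
  have [|z zE] := short_exact_lift_hom ex (a := @mod_sub F gT G W B w v).
    by rewrite mulmxBl vE subrr.
  exists z; apply/heq_subP/heq0P; rewrite /= -zE /=.
  by rewrite addrAC subrr sub0r; exact: nullN.
- move=> W w /heq0P; have [_ ps _] := exA; case/(null_lift ps)=> t tE tn.
  (* Start from a linear lift of w along g and correct it by a multiple of f,
     so that its composite with u becomes t; the pair (w, t) then determines
     v, and v is equivariant. *)
  have [_ /row_fullP[s sg] _] := ex.
  pose v0 := mmx w *m s.
  have v0g : v0 *m mmx g = mmx w by rewrite -mulmxA sg mulmx1.
  have [|y yE] := short_exact_lift exA (a := v0 *m mmx u - mmx t).
    by rewrite mulmxBl tE -mulmxA -gh mulmxA v0g subrr.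
  pose v := v0 - y *m mmx f.
  have vg : v *m mmx g = mmx w.
    by rewrite mulmxBl v0g -(mulmxA y) (short_exact_comp0 ex) mulmx0 subr0.
  have vu : v *m mmx u = mmx t.
    by rewrite mulmxBl -(mulmxA y) fu -yE subKr.
  have vP x : x \in G -> W x *m v = v *m B x.
    move=> Gx; apply/eqP; rewrite -subr_eq0; apply/eqP; apply: joint.
      by rewrite mulmxBl -!mulmxA (mmxP g) // [in X in _ - X]mulmxA vg (mmxP w)
        // subrr.
    by rewrite mulmxBl -!mulmxA (mmxP u) // [in X in _ - X]mulmxA vu (mmxP t)
      // subrr.
  by exists (ModHom vP); apply: stable_of_eq.
- move=> W w /heq0P; have [_ ps _] := exB; case/(null_lift ps)=> t tE tn.
  have [_ /row_fullP[s spi] _] := exA.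
  pose f1 := mod_tensh (mod_reg F G) f.
  have [w0 w0p] : exists w0, w0 *m mmx (cosyz_proj A) = mmx w.
    by exists (mmx w *m s); rewrite -mulmxA spi mulmx1.
  have [|y yE] := short_exact_lift exB (a := w0 *m mmx f1 - mmx t).
    rewrite mulmxBl tE -mulmxA -cosyz_proj_natural mulmxA w0p.
    by rewrite subrr.
  (* The defects of equivariance of w0 and y come from one and the same map z
     to A. *)
  have diff x : x \in G -> exists2 z,
      W x *m w0 - w0 *m hull A x = z *m mmx (cosyz_inj A) &
      W x *m y - y *m B x = z *m mmx f.
    move=> Gx; have [|z zE] := short_exact_lift exA (a :=
      W x *m w0 - w0 *m hull A x).
      rewrite mulmxBl -!mulmxA (mmxP (cosyz_proj A)) // w0p [X in _ - X]mulmxA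
        w0p.
      by rewrite (mmxP w) // subrr.
    exists z => //; apply: (short_exact_injK exB).
    rewrite -[RHS]mulmxA -cosyz_inj_natural [RHS]mulmxA -zE.
    rewrite !mulmxBl -!mulmxA (mmxP (cosyz_inj B)) // -yE [in X in _ - X]mulmxA
      -yE.
    rewrite mulmxBr mulmxBl -!mulmxA (mmxP t) // (mmxP f1) // opprB.
    by rewrite addrA subrK.
  have vP x : x \in G -> W x *m (y *m mmx g) = (y *m mmx g) *m C x.
    move=> Gx; apply/eqP; rewrite -subr_eq0 mulmxA -(mulmxA y) -(mmxP g) //.
    rewrite [X in _ - X]mulmxA -mulmxBl; have [z _ ->] := diff x Gx.
    by rewrite -mulmxA (short_exact_comp0 ex) mulmx0.
  have cP x : x \in G ->
      W x *m (y *m mmx u - w0) = (y *m mmx u - w0) *m hull A x.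
    move=> Gx; apply/eqP; rewrite -subr_eq0.
    have [z zw zy] := diff x Gx.
    have -> : W x *m (y *m mmx u - w0) - (y *m mmx u - w0) *m hull A x =
        (W x *m y - y *m B x) *m mmx u - (W x *m w0 - w0 *m hull A x).
      rewrite mulmxBr !mulmxBl -!mulmxA (mmxP u) // !opprB.
      by rewrite addrACA [- _ - _]addrC addrACA.
    by rewrite zw zy -mulmxA fu subrr.
  exists (ModHom vP); apply/heq_subP/heq0P => /=.
  have -> : y *m mmx g *m mmx h - mmx w = (y *m mmx u - w0) *m mmx (cosyz_proj
    A).
    by rewrite mulmxBl w0p -!mulmxA gh.
  exact: hull_null_from (ModHom cP) (cosyz_proj A).
Qed.

End ExactTriangles.

(** * Consequences of exactness *)

Section TriangulatedStructure.
Variables (F : fieldType) (gT : finGroupType) (G : {group gT}).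
Local Notation rep := (representation F G).
Local Notation K := (stab F G).
Local Notation hull M := (mod_tens (mod_reg F G) M).

Lemma dist_hom_exact (X : triangle K) : dist X -> hom_exact X.
Proof.
case=> Y /exact_triangle_hom_exact eY /triangle_iso_retract[+ _].
by move/hom_exact_retract; apply.
Qed.

Lemma exact_triangle_dist (X : triangle K) : exact_triangle X -> dist X.
Proof. by move=> eX; exists X => //; exact: triangle_iso_refl. Qed.

(** The inclusion of A in kG (x) A extends to B, and the extension induces h
    on the cokernels. *)
Lemma short_exact_triangle (A B C : rep) (f : modhom A B) (g : modhom B C) :
  short_exact f g ->
  exists h : modhom C (cosyz A), exact_triangle (@Triangle K A B C f g h).
Proof.
move=> ex; have [ff _ _] := ex.
have n : null A (hull A) (mmx (cosyz_inj A)).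
  have := hull_null_from (cosyz_inj A) (mod_id (hull A)).
  by rewrite mulmx1.
have [u fu _] := null_extend ff n.
have [|h hE] := short_exact_factor_hom ex (a := mod_comp u (cosyz_proj A)).
  by rewrite [LHS]mulmxA fu (short_exact_comp0 (cosyz_exact A)).
by exists h; split=> //; exists u => //=.
Qed.

Lemma short_exact_coker (A B : rep) (f : modhom A B) :
  row_free (mmx f) -> exists C (g : modhom B C), short_exact f g.
Proof.
move=> ff; pose U := <<mmx f>>%MS.
have mU : mxmodule B U.
  apply/mxmoduleP=> s Gs; rewrite (eqmxMr _ (genmxE _)) genmxE -mmxP //.
  exact: submxMl.
exists (Representation (factmod_repr mU)).
have gP s : s \in G -> B s *m in_factmod U 1%:M = in_factmod U 1%:M *m
  factmod_repr mU s.
  by move=> Gs; rewrite -in_factmodE -in_factmodJ // mul1mx.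
exists (@ModHom _ _ _ B (Representation (factmod_repr mU)) _ gP).
have surj : row_full (in_factmod U 1%:M : 'M_(rdegree B, _)).
  apply/row_fullP; exists (val_factmod 1%:M).
  by rewrite -in_factmodE val_factmodK.
split=> //=; have sub : (mmx f <= kermx (in_factmod U 1%:M))%MS.
  apply/sub_kermxP/eqP; rewrite -in_factmodE in_factmod_eq0.
  by rewrite genmxE.
apply/eqmxP; rewrite -(geq_leqif (mxrank_leqif_eq sub)) mxrank_ker (eqP surj).
by rewrite mxrank_coker mxrank_gen subKn // rank_leq_col.
Qed.

(** Axiom TR3. The square commutes up to a null map from A, which extends to
    B; after subtracting the extension from b the square commutes strictly and
    c is the map induced on cokernels. The last square then commutes up to a
    map through kG (x) A'. *)
Lemma exact_triangle_fill (X Y : triangle K) (a : hom (tri1 X) (tri1 Y))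
    (b : hom (tri2 X) (tri2 Y)) :
  exact_triangle X -> exact_triangle Y -> tri12 X ;; b ~= a ;; tri12 Y ->
  exists c, tri23 X ;; c ~= b ;; tri23 Y /\ tri31 X ;; shifth a ~= c ;; tri31 Y.
Proof.
case: X a b => A B C f g h a b /= [/= ex [u fu gh]]; rewrite /= in u fu gh.
case: Y a b => A' B' C' f' g' h' a b /= [/= ex' [u' fu' gh']].
rewrite /= in u' fu' gh' a b *.
move=> /stable_nullP; have [ff _ _] := ex.
case/(null_extend ff)=> d fd dn.
pose b' : modhom B B' := @mod_sub F gT G B B' b d.
have fb' : mmx f *m mmx b' = mmx a *m mmx f'.
  by rewrite mulmxBr fd /= subKr.
have [|c cE] := short_exact_factor_hom ex (a := mod_comp b' g').
  by rewrite [LHS]mulmxA fb' -mulmxA (short_exact_comp0 ex') mulmx0.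
exists c; split.
  apply/stable_nullP; rewrite /= -cE /= mulmxBl addrAC subrr sub0r.
  by apply: nullN; apply: nullMr.
pose a1 := mod_tensh (mod_reg F G) a.
have [|w wE] := short_exact_factor_hom ex
    (a := @mod_sub F gT G B (hull A') (mod_comp u a1) (mod_comp b' u')).
  rewrite mulmxBr [X in X - _]mulmxA [X in _ - X]mulmxA fu fb' -mulmxA fu'.
  by rewrite cosyz_inj_natural subrr.
apply/stable_nullP; suff -> : mmx (mod_comp h (shifth (s:=K) a)) - mmx
  (mod_comp c h')
    = mmx w *m mmx (cosyz_proj A').
  exact: (hull_null_from w (cosyz_proj A')).
apply: (short_exact_surjK ex); rewrite mulmxBr [RHS]mulmxA -wE mulmxBl.
congr (_ - _).
  rewrite [LHS]mulmxA gh -[LHS]mulmxA [X in _ *m X = _]cosyz_proj_natural.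
  by rewrite mulmxA.
by rewrite [LHS]mulmxA -cE /= -[LHS]mulmxA gh' mulmxA.
Qed.

Lemma dist_fill (X Y : triangle K) (a : hom (tri1 X) (tri1 Y))
    (b : hom (tri2 X) (tri2 Y)) :
  exact_triangle X -> dist Y -> tri12 X ;; b ~= a ;; tri12 Y ->
  exists c, tri23 X ;; c ~= b ;; tri23 Y /\ tri31 X ;; shifth a ~= c ;; tri31 Y.
Proof.
move=> eX [Z eZ /triangle_iso_retract[[s [r [sr1 sr2 sr3]]] _]] ab.
have [|c [gc hc]] := exact_triangle_fill (a := a ;; tmap1 s) (b := b ;;
  tmap2 s) eX eZ.
  by rewrite comphA ab -!comphA (tmap12 s).
exists (c ;; tmap3 r); split.
  by rewrite comphA gc -!comphA (tmap23 r) (comphA (tmap2 s)) sr2 comp1h.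
rewrite -comphA -(tmap31 r) comphA -hc -comphA -shift_comp -comphA sr1.
by rewrite comph1.
Qed.

(** If the suspension of A is zero, so is its identity, and the suspension is
    faithful. *)
Lemma projective_shift (A : K) : projective (shift A) <-> projective A.
Proof.
split=> [pS|pA]; last exact: projective_tens.
apply/projective_heq0; apply: shift_faithful.
exact: projective_from.
Qed.

(** In the stable category the projective modules are the zero objects, so
    that this is two out of three for vanishing in a long exact sequence. *)
Lemma dist_projective (X : triangle K) : dist X ->
  [/\ projective (tri1 X) -> projective (tri2 X) -> projective (tri3 X),
      projective (tri2 X) -> projective (tri3 X) -> projective (tri1 X)
    & projective (tri1 X) -> projective (tri3 X) -> projective (tri2 X)].
Proof.
move=> /dist_hom_exact[_ _ _ l2 l3 l1]; split=> p q.
- have [|v vE] := l3 _ (idh (tri3 X)).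
    by apply: projective_to; apply/projective_shift.
  by apply: projective_retract vE q.
- apply/projective_shift; have [|v vE] := l1 _ (idh (shift (tri1 X))).
    by apply: projective_to; apply/projective_shift.
  by apply: projective_retract vE q.
- have [|v vE] := l2 _ (idh (tri2 X)); first exact: projective_to.
  by apply: projective_retract vE p.
Qed.

(** Exactness gives a right inverse v of the first morphism; the suspension of
    the defect of v as a left inverse factors through the third term. *)
Lemma dist_projective_iso (X : triangle K) :
  dist X -> projective (tri3 X) -> is_iso (tri12 X).
Proof.
move=> /dist_hom_exact[_ _ _ l2 l3 l1] p3.
have [|v vE] := l2 _ (idh (tri2 X)); first exact: projective_to.
exists v; split=> //; apply/heq_subP; apply: shift_faithful.
have [|w <-] := l1 _ (shifth (mod_sub (tri12 X ;; v) (idh (tri1 X)))).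
  by rewrite -shift_comp mod_sub_comp -comphA vE comph1 comp1h mod_subrr
    shift_zero.
by rewrite (projective_to w p3) mod_0comp.
Qed.

Lemma dist_iso_projective (X : triangle K) :
  dist X -> is_iso (tri12 X) -> projective (tri3 X).
Proof.
move=> /dist_hom_exact[c12 _ c31 _ l3 _] [f' [ff' f'f]].
have [|v vE] := l3 _ (idh (tri3 X)).
  rewrite comp1h -(comph1 (tri31 X)) -shift_id -ff' shift_comp comphA c31.
  exact: mod_0comp.
apply/projective_heq0; rewrite -vE -(comp1h (tri23 X)) -f'f -(comphA f') c12.
by rewrite !mod_comp0.
Qed.

Lemma biproduct_direct_sum (A B D : rep) (i : modhom A D) (p : modhom D A)
    (j : modhom B D) (q : modhom D B) :
  mmx i *m mmx p = 1%:M -> mmx j *m mmx q = 1%:M ->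
  mmx i *m mmx q = 0 -> mmx j *m mmx p = 0 ->
  mmx p *m mmx i + mmx q *m mmx j = 1%:M ->
  @is_direct_sum K A B D i j.
Proof.
move=> ip jq iq jp pq X f h.
exists (mod_add (mod_comp p f : hom (D : K) X) (mod_comp q h)); first split.
- apply: stable_of_eq; rewrite /= mulmxDr !mulmxA ip iq mul1mx mul0mx.
  by rewrite addr0.
- apply: stable_of_eq; rewrite /= mulmxDr !mulmxA jq jp mul1mx mul0mx.
  by rewrite add0r.
move=> h' /stable_nullP ih /stable_nullP jh; apply/stable_nullP => /=.
rewrite -[mmx h']mul1mx -pq mulmxDl opprD addrACA -!mulmxA -!mulmxBr.
by apply: nullD; apply: nullMl.
Qed.

Lemma split_mono_direct_sum (A D : rep) (i : modhom A D) (p : modhom D A) :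
  mmx i *m mmx p = 1%:M ->
  exists B (j : modhom B D), @is_direct_sum K A B D i j.
Proof.
move=> ip; pose U := kermx (mmx p).
have mU : mxmodule D U.
  apply/mxmoduleP=> s Gs; apply/sub_kermxP.
  by rewrite -mulmxA mmxP // mulmxA mulmx_ker mul0mx.
pose B : rep := Representation (submod_repr mU).
have jP s : s \in G -> B s *m val_submod 1%:M = (val_submod 1%:M : 'M_(\rank U,
  _)) *m D s.
  by move=> Gs; rewrite -val_submodJ // mul1mx /= -val_submodE.
pose j : modhom B D := @ModHom _ _ _ B D _ jP.
pose e := 1%:M - mmx p *m mmx i.
have eU : (e <= U)%MS.
  by apply/sub_kermxP; rewrite mulmxBl mul1mx -mulmxA ip mulmx1 subrr.
have qP s : s \in G -> D s *m in_submod U e = in_submod U e *m B s.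
  move=> Gs; rewrite /= -in_submodJ // in_submodE mulmxA -in_submodE.
  rewrite mulmxBr mulmxBl mulmx1 mul1mx mulmxA mmxP //.
  by rewrite -!mulmxA (mmxP i).
pose q : modhom D B := @ModHom _ _ _ D B _ qP.
have jp : mmx j *m mmx p = 0 by apply/sub_kermxP; rewrite /= val_submod1.
have qj : mmx q *m mmx j = e by rewrite /= -val_submodE in_submodK.
exists B, j; apply: (@biproduct_direct_sum _ _ _ i p j q) => //.
- rewrite /= in_submodE mulmxA -in_submodE mulmxBr mulmx1 mulmxA jp mul0mx.
  by rewrite subr0 val_submodK.
- by rewrite /= in_submodE mulmxA -in_submodE mulmxBr mulmx1 mulmxA ip mul1mx
    subrr linear0.
by rewrite qj addrC subrK.
Qed.

End TriangulatedStructure.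

(** * Splitting idempotents by Fitting's lemma *)

Section IdempotentSplitting.
Variables (F : fieldType) (gT : finGroupType) (G : {group gT}).
Local Notation rep := (representation F G).
Local Notation K := (stab F G).
Variables (A : rep) (e : modhom A A).

(** A power of the homomorphism itself, not only of its matrix, as
    equivariance of the powers is needed. *)
Definition mod_pow m : modhom A A := iter m (mod_comp e) (mod_id A).

Lemma mod_powD m1 m2 :
  mmx (mod_pow (m1 + m2)) = mmx (mod_pow m1) *m mmx (mod_pow m2).
Proof.
elim: m1 => [|m1 IH]; first by rewrite mul1mx.
by rewrite addSn /= IH mulmxA.
Qed.

(** The images decrease; N is chosen so that the rank is minimal. *)
Lemma mod_pow_stationary :
  exists N, forall m, (mmx (mod_pow (N + m)) :=: mmx (mod_pow N))%MS.
Proof.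
pose P r := `[< exists N, \rank (mmx (mod_pow N)) = r >].
have exP : exists r, P r by exists (\rank (mmx (mod_pow 0))); apply/asboolP;
  exists 0%N.
case: (ex_minnP exP) => r /asboolP[N Nr] rmin; exists N => m.
have sub : (mmx (mod_pow (N + m)) <= mmx (mod_pow N))%MS.
  by rewrite addnC mod_powD submxMl.
apply/eqmxP; rewrite -(geq_leqif (mxrank_leqif_eq sub)) Nr; apply: rmin.
by apply/asboolP; exists (N + m)%N.
Qed.

(** Let U be the stationary image of the powers of e, and r m the power e ^ (N
    + m) seen as a map to U. As e ^ 2 = e up to null maps, the maps r m agree
    for m > 0 up to null maps, and the restriction phi of e ^ (N + 1) to U is
    stably idempotent. As phi is invertible, it is stably the identity. *)
Lemma stable_idem_split : (e : hom (A : K) A) ;; e ~= e ->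
  exists (B : K) (r : hom (A : K) B) (s : hom B A), s ;; r ~= idh B /\ r ;;
    s ~= e.
Proof.
move=> /stable_nullP e2; have [N stN] := mod_pow_stationary.
pose U := mmx (mod_pow N).
have mU : mxmodule A U.
  by apply/mxmoduleP=> g Gg; rewrite -(mmxP (mod_pow N)) // submxMl.
pose B : rep := Representation (submod_repr mU).
have sP g : g \in G ->
    B g *m val_submod 1%:M = (val_submod 1%:M : 'M_(\rank U, _)) *m A g.
  by move=> Gg; rewrite -val_submodJ // mul1mx /= -val_submodE.
pose s : modhom B A := @ModHom _ _ _ B A _ sP.
have powU m : (mmx (mod_pow (N + m)) <= U)%MS by rewrite stN.
have rP m g : g \in G -> A g *m in_submod U (mmx (mod_pow (N + m))) =
    in_submod U (mmx (mod_pow (N + m))) *m B g.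
  move=> Gg; rewrite /= -in_submodJ // -(mmxP (mod_pow _)) //.
  by rewrite in_submodE mulmxA -in_submodE.
pose r m : modhom A B := @ModHom _ _ _ A B _ (rP m).
have rs m : mmx (r m) *m mmx s = mmx (mod_pow (N + m)).
  by rewrite /= -val_submodE in_submodK.
have rD m k : mmx (r (k + m)%N) = mmx (mod_pow k) *m mmx (r m).
  have rE l : mmx (r l) = mmx (mod_pow (N + l)) *m in_submod U 1%:M.
    exact: in_submodE.
  by rewrite !rE addnCA mod_powD -mulmxA.
(* The difference of r (m + 1) and r m is e ^ 2 - e followed by r (m - 1),
   which exists for m > 0 only; this is why the powers start at m = 1. *)
have rr m k : null A B (mmx (r (k + m.+1)%N) - mmx (r m.+1)).
  elim: k => [|k IH]; first by rewrite subrr; exact: null0.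
  rewrite addSnnS -(subrK (mmx (r (k + m.+1)%N)) (mmx (r (k + m.+2)%N))) -addrA.
  apply: nullD IH; rewrite -!addSnnS.
  have -> : mmx (r (k.+2 + m)%N) - mmx (r (k.+1 + m)%N) =
      (mmx e *m mmx e - mmx e) *m mmx (r (k + m)%N).
    rewrite mulmxBl (rD (k + m)%N 1%N) -[(k.+2 + m)%N]/(2 + (k + m))%N rD.
    by rewrite /= !mulmx1.
  exact: nullMr.
have powe m : null A A (mmx (mod_pow m.+1) - mmx e).
  elim: m => [|m IH]; first by rewrite /= mulmx1 subrr; exact: null0.
  rewrite -(subrK (mmx e *m mmx e) (mmx (mod_pow m.+2))) -addrA.
  by apply: nullD e2; rewrite [X in X - _]/= -mulmxBr; exact: nullMl.
pose phi := mod_comp s (r 1%N).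
have phi2 : null B B (mmx phi *m mmx phi - mmx phi).
  have -> : mmx phi *m mmx phi - mmx phi =
      mmx s *m (mmx (r ((N + 1) + 1)%N) - mmx (r 1%N)).
    by rewrite mulmxBr rD -rs /= !mulmxA.
  by apply: nullMl.
have sU : (mmx s :=: U)%MS by exact: val_submod1.
have phiU : mmx phi \in unitmx.
  have rk : \rank (mmx phi *m mmx s) = rdegree B.
    rewrite -mulmxA rs (eqmxMr _ sU) -mod_powD.
    by rewrite stN.
  rewrite -row_free_unit -row_leq_rank -{1}rk.
  exact: mxrankM_maxl.
have psiP g : g \in G -> B g *m invmx (mmx phi) = invmx (mmx phi) *m B g.
  move=> Gg; rewrite -[LHS](mulKmx phiU) [mmx phi *m _]mulmxA -(mmxP phi) //.
  by rewrite mulmxK.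
exists B, (r 1%N), s; split; apply/stable_nullP; last first.
  by rewrite [X in X - _]rs addn1; exact: powe.
suff -> : mmx (mod_comp s (r 1%N)) - 1%:M =
    invmx (mmx phi) *m (mmx phi *m mmx phi - mmx phi).
  exact: (nullMl (ModHom psiP) phi2).
by rewrite mulmxBr mulmxA mulVmx // mul1mx.
Qed.

End IdempotentSplitting.

(** * Modules over p-groups *)

Section PGroups.
Variables (F : fieldType) (gT : finGroupType) (G : {group gT}).
Local Notation rep := (representation F G).
Local Notation K := (stab F G).
Local Notation hull M := (mod_tens (mod_reg F G) M).

(** Adding a projective summand does not change the stable isomorphism class.
    *)
Lemma dadd_projective_iso (N Q : K) : projective Q ->
  inverse_of (mod_col (mod_id N) (mod_zero Q N) : hom (dadd_grepr N Q : K) N)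
    (mod_inl N Q).
Proof.
move=> pQ; split; last first.
  by apply: stable_of_eq; rewrite /= mul_row_col mulmx1 mulmx0 addr0.
apply/heq_subP/heq0P.
pose r : modhom (dadd_grepr N Q) Q := mod_col (mod_zero N Q) (mod_id Q).
pose b : modhom (dadd_grepr N Q) N := mod_col (mod_id N) (mod_zero Q N).
have e : 1%:M = mmx b *m mmx (mod_inl N Q) + mmx r *m mmx (mod_inr N Q).
  rewrite /= !mul_col_row !mul0mx !mulmx0 !mulmx1 add_block_mx.
  by rewrite !(addr0, add0r) -scalar_mx_block.
change (null (dadd_grepr N Q) (dadd_grepr N Q) (mmx b *m mmx (mod_inl N Q) -
  1%:M)).
by rewrite e opprD addrA subrr add0r; apply: nullN; exact: null_projective.
Qed.

(** Adding kG (x) M to N makes f injective without changing it in the stable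
    category; the cokernel is then a cone of f. *)
Lemma cone_exists (M N : rep) (f : modhom M N) :
  exists C (g : modhom (dadd_grepr N (hull M)) C),
    short_exact (mod_row f (cosyz_inj M)) g.
Proof.
apply: short_exact_coker; apply: inj_row_free => v /=.
rewrite mul_mx_row -[RHS]row_mx0 => /eq_row_mx[_ v0].
by apply: (short_exact_injK (cosyz_exact M)); rewrite mul0mx.
Qed.

Definition mod_triv : rep :=
  Representation (MxRepresentation
    (conj (erefl _) (fun _ _ _ _ => esym (mulmx1 1%:M)) : mx_repr G (fun=> 1%:M
      : 'M[F]_1))).

Section FixedVector.
Variables (M : rep) (v : 'rV[F]_(rdegree M)).
Hypothesis vG : forall g, g \in G -> v *m M g = v.

Lemma fixed_homP g : g \in G -> mod_triv g *m v = v *m M g.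
Proof. by move=> Gg; rewrite mul1mx vG. Qed.

Definition fixed_hom : modhom mod_triv M := @ModHom _ _ _ mod_triv M v
  fixed_homP.
End FixedVector.

Definition mod_norm (M : rep) := \sum_(g in G) M g.

Lemma norm_hom (M N : rep) (f : modhom M N) :
  mod_norm M *m mmx f = mmx f *m mod_norm N.
Proof.
by rewrite mulmx_suml mulmx_sumr; apply: eq_bigr => g Gg; exact: mmxP.
Qed.

(** If 1 is the relative trace of t, a fixed W is W t times the norm. *)
Lemma fixed_sub_norm (P : rep) m (W : 'M_(m, rdegree P)) : projective P ->
  (forall g, g \in G -> W *m P g = W) -> (W <= mod_norm P)%MS.
Proof.
move=> /projective_trace[t t1] WG; apply/submxP; exists (W *m t).
rewrite -[LHS]mulmx1 -t1 !mulmx_sumr; apply: eq_bigr => g Gg.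
by rewrite !mulmxA WG ?groupV.
Qed.

Variable p : nat.
Hypotheses (charF : p \in [pchar F]) (pG : (p.-group G)%g).

Lemma pgroup_fixed (M : rep) : (0 < rdegree M)%N ->
  exists2 v : 'rV_(rdegree M), v != 0 & forall g, g \in G -> v *m M g = v.
Proof.
move=> M0; have := rfix_pgroup_pchar charF M M0 pG (subxx _).
move=> /rowV0Pn[v vfix v0]; exists v => //.
exact/rfix_mxP.
Qed.

(** The kernel is a module over a p-group, and would contain a nonzero fixed
    vector. *)
Lemma pgroup_inj (M N : rep) (f : modhom M N) :
  (forall v : 'rV_(rdegree M), (forall g, g \in G -> v *m M g = v) ->
    v *m mmx f = 0 -> v = 0) -> row_free (mmx f).
Proof.
move=> injf; rewrite -kermx_eq0; apply: contraT => K0.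
have mU : mxmodule M (kermx (mmx f)).
  apply/mxmoduleP=> s Gs; apply/sub_kermxP.
  by rewrite -mulmxA mmxP // mulmxA mulmx_ker mul0mx.
pose B : rep := Representation (submod_repr mU).
have [|v v0 vfix] := @pgroup_fixed B; first by rewrite /= lt0n mxrank_eq0.
case/eqP: v0; apply/eqP; rewrite -(val_submod_eq0 v); apply/eqP/injf.
  by move=> g Gg; rewrite -(val_submodJ mU) //; congr val_submod; exact: vfix.
by apply/sub_kermxP; exact: val_submodP.
Qed.

Lemma pgroup_filtration (M : rep) : (0 < rdegree M)%N ->
  exists C (f : modhom mod_triv M) (g : modhom M C), short_exact f g.
Proof.
case/pgroup_fixed=> v v0 vfix; pose f := fixed_hom vfix.
have [|C [g fg]] := short_exact_coker (f := f); last by exists C, f, g.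
by rewrite /row_free /= rank_rV v0.
Qed.

(** Send 1 in kG to a vector v that the norm does not kill. The fixed vectors
    of kG are the multiples of the norm element, so that the map is injective.
    *)
Lemma norm_split (M : rep) : mod_norm M != 0 ->
  exists C (f : modhom (mod_reg F G) M) (g : modhom M C), short_exact f g.
Proof.
move=> /rowV0Pn[w /submxP[v ->] vN].
pose f := lin1_mx (mulmx v \o gring_mx M).
have fE a : a *m f = v *m gring_mx M a by rewrite mul_rV_lin1.
have fP g : g \in G -> mod_reg F G g *m f = f *m M g.
  move=> Gg; apply/row_matrixP=> i; rewrite !row_mul !rowE !fE.
  by rewrite gring_mxJ // mulmxA.
have [|C [g fg]] := short_exact_coker (f := @ModHom _ _ _ (mod_reg F G) M f
  fP); last first.
  by exists C, (@ModHom _ _ _ (mod_reg F G) M f fP), g.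
apply: pgroup_inj => a afix af0.
have ac j : a 0 j = a 0 (gring_index G 1%g).
  rewrite -[in LHS](afix (enum_val j)) ?enum_valP // mxE.
  rewrite (bigD1 (gring_index G 1%g)) //= !mxE gring_indexK // mul1g gring_valK.
  rewrite !eqxx mulr1 big1 ?addr0 // => i i1; rewrite !mxE /=.
  case: eqP => [e|_]; last by rewrite mulr0.
  case/eqP: i1; rewrite -[i]gring_valK; congr gring_index.
  move/(congr1 (fun k => enum_val k * (enum_val j)^-1)%g): e.
  by rewrite gring_indexK ?groupM ?enum_valP // mulgK mulgV.
have aE : a = a 0 (gring_index G 1%g) *: norm_row F G.
  by apply/rowP=> j; rewrite !mxE mulr1.
have nE : gring_mx M (norm_row F G) = mod_norm M.
  rewrite /gring_mx /= mulmx_sum_row linear_sum /= [RHS](reindex_onto enum_val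
    (gring_index G)) /=; last first.
    by move=> x Gx; rewrite gring_indexK.
  apply: eq_big => [i|i _]; first by rewrite enum_valP gring_valK eqxx.
  by rewrite mxE scale1r rowK mxvecK.
move: af0; rewrite /= fE aE linearZ /= nE -scalemxAr => /eqP.
by rewrite scaler_eq0 (negbTE vN) orbF => /eqP->; rewrite scale0r.
Qed.

Lemma short_exact_projective (A B C : rep) (f : modhom A B) (g : modhom B C) :
  short_exact f g ->
  [/\ projective A -> projective B -> projective C,
      projective B -> projective C -> projective A
    & projective A -> projective C -> projective B].
Proof.
by move=> /short_exact_triangle[h /exact_triangle_dist/dist_projective].
Qed.

Lemma mod_reg_projective : projective (mod_reg F G).
Proof.
by have [t] := @mod_reg_trace F gT G; exact: rel_trace_projective.
Qed.

Lemma short_exact_thick (S : set K) (A B C : rep) (f : modhom A B)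
    (g : modhom B C) : short_exact f g -> thick S ->
  [/\ S A -> S B -> S C, S B -> S C -> S A & S A -> S C -> S B].
Proof.
move=> /short_exact_triangle[h /exact_triangle_dist dX] [_ _ tri _].
exact: tri dX.
Qed.

Lemma thick_projective (S : set K) (A : K) : thick S -> projective A -> S A.
Proof. by case=> z _ _ _ /projective_is_zero; exact: z. Qed.

(** As long as the norm does not vanish on M, a copy of kG can be split off
    and the dimension drops by the order of G. Thick subcategories do not see
    projective modules. *)
Lemma norm_reduction (M : rep) : exists M' : rep,
  [/\ mod_norm M' = 0, projective M <-> projective M',
      rdegree M = rdegree M' %[mod #|G|]
    & forall S : set K, thick S -> S M -> S M'].
Proof.
have [n le_n] := ubnP (rdegree M); elim: n => // n IH in M le_n *.
have [N0|] := eqVneq (mod_norm M) 0; first by exists M.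
case/norm_split=> C [f [g fg]].
have dM : rdegree M = (#|G| + rdegree C)%N := short_exact_degree fg.
have [|M' [N0 pM' dM' tM']] := IH C.
  by rewrite -ltnS (leq_trans _ le_n) // dM ltnS -[X in (X < _)%N]add0n
    ltn_add2r cardG_gt0.
have [pC _ pM] := short_exact_projective fg.
have pR := mod_reg_projective.
exists M'; split=> //.
- by rewrite -pM'; split=> [|/pM]; [exact: pC | exact].
- by rewrite dM modnDl.
move=> S tS SM; apply: tM' => //.
have [SC _ _] := short_exact_thick fg tS.
by apply: SC => //; exact: thick_projective.
Qed.

(** A nonzero module has a nonzero fixed vector, which lies in the image of
    the norm when the module is projective. *)
Lemma norm0_projective (M : rep) :
  mod_norm M = 0 -> projective M -> rdegree M = 0%N.
Proof.
move=> N0 pM; apply/eqP; rewrite eqn0Ngt; apply/negP => /pgroup_fixed[v v0].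
by move=> /(fixed_sub_norm pM); rewrite N0 submx0 (negbTE v0).
Qed.

Lemma projective_degree (M : rep) : projective M -> (#|G| %| rdegree M)%N.
Proof.
have [M' [N0 -> dM _]] := norm_reduction M => /(norm0_projective N0) M0.
by rewrite /dvdn dM M0 mod0n.
Qed.

Lemma projective_null_degree (M : rep) : rdegree M = 0%N -> projective M.
Proof.
move=> M0; apply/projective_null; suff -> : 1%:M = 0 :> 'M[F]_(rdegree M).
  exact: null0.
by apply/matrixP=> i; exfalso; move: i; rewrite M0 => -[].
Qed.

(** The cone of an isomorphism is projective, so its dimension is divisible by
    the order of G; so is that of kG (x) M. *)
Lemma stable_iso_degree (M N : K) (f : hom M N) :
  is_iso f -> rdegree M = rdegree N %[mod #|G|].
Proof.
move=> fI; have [C [g fg]] := cone_exists f.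
have [bi ib] := dadd_projective_iso N (@mod_reg_tens_projective F gT G M).
have [h /exact_triangle_dist dX] := short_exact_triangle fg.
pose f1 : hom M (dadd_grepr N (hull M) : K) := mod_row f (cosyz_inj M).
have f1b : f1 ;; mod_col (mod_id N) (mod_zero (hull M) N) ~= f.
  by apply: stable_of_eq; rewrite /= mul_row_col mulmx1 mulmx0 addr0.
have fI1 : is_iso f1.
  apply: is_iso_heq (_ : f ;; mod_inl N (hull M) ~= _) _; last first.
    by apply: is_iso_comp => //; eexists; split; [exact: ib | exact: bi].
  by rewrite -f1b -comphA bi comph1.
have pC : projective C := dist_iso_projective dX fI1.
have := short_exact_degree fg; rewrite /= => e.
move/(congr1 (modn^~ #|G|)): e; rewrite [(#|G| * _)%N]mulnC addnC modnMDl.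
by rewrite -modnDmr (eqP (projective_degree pC)) addn0.
Qed.

End PGroups.

(** * Dimensions in direct factors of distinguished triangles *)

Section RetractedTriangles.
Variables (F : fieldType) (gT : finGroupType) (G : {group gT}).
Local Notation rep := (representation F G).
Local Notation K := (stab F G).
Local Notation hull M := (mod_tens (mod_reg F G) M).

(** The five lemma for Hom(W, -): injectivity of composition with c holds for
    all W, and a section d of c comes from surjectivity for W the third term
    of Y; injectivity then shows that d is an inverse. *)
Lemma hom_exact_five (Z Y : triangle K) (b : hom (tri2 Z) (tri2 Y))
    (a : hom (tri1 Z) (tri1 Y)) (c : hom (tri3 Z) (tri3 Y)) :
  hom_exact Z -> hom_exact Y -> is_iso a -> is_iso b ->
  tri12 Z ;; b ~= a ;; tri12 Y -> tri23 Z ;; c ~= b ;; tri23 Y ->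
  tri31 Z ;; shifth a ~= c ;; tri31 Y -> is_iso c.
Proof.
move=> [Z12 Z23 Z31 Zl2 Zl3 Zl1] [Y12 Y23 Y31 Yl2 Yl3 Yl1].
move=> [a' [aa' a'a]] [b' [bb' b'b]] fb gc hc.
have sa : shifth a ;; shifth a' ~= idh _ by rewrite -shift_comp aa' shift_id.
have sa' : shifth a' ;; shifth a ~= idh _ by rewrite -shift_comp a'a shift_id.
have fb' : tri12 Y ;; b' ~= a' ;; tri12 Z.
  by rewrite -(comp1h (tri12 Y)) -a'a -(comphA a') -fb -!comphA bb' comph1.
have inj (W : K) (w : hom W (tri3 Z)) : w ;; c ~= mod_zero _ _ ->
  w ~= mod_zero _ _.
  move=> wc; have [|v vw] := Zl3 W w.
    by rewrite -(comph1 (tri31 Z)) -sa (comphA (tri31 Z)) hc !comphA wc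
      !mod_0comp.
  have [|t tE] := Yl2 _ (v ;; b); first by rewrite -comphA -gc comphA vw.
  rewrite -vw -(comph1 v) -bb' (comphA v) -tE -!comphA.
  by rewrite (comphA (tri12 Y)) fb' -!comphA Z12 !mod_comp0.
have [d dc] : exists d, d ;; c ~= idh (tri3 Y).
  have [|v vE] := Zl1 _ (tri31 Y ;; shifth a').
    rewrite -comphA -shift_comp -fb' shift_comp comphA Y31; exact: mod_0comp.
  have [|t tE] := Yl3 _ (mod_sub (idh _) (v ;; c)).
    rewrite mod_sub_comp comp1h -comphA -hc comphA vE -comphA sa' comph1.
    exact: mod_subrr.
  exists (mod_add v (t ;; b' ;; tri23 Z)).
  rewrite mod_add_comp -!comphA gc (comphA b') b'b comp1h tE.
  by apply: stable_of_eq; rewrite /= addrC subrK.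
exists d; split=> //; apply/heq_subP; apply: inj.
by rewrite mod_sub_comp -comphA dc comph1 comp1h mod_subrr.
Qed.

Variable p : nat.
Hypotheses (charF : p \in [pchar F]) (pG : (p.-group G)%g).

(** Let Z be a distinguished triangle on the first morphism of Y. It maps to X
    through the inclusion of Y, hence to Y; this last map is an isomorphism by
    the five lemma. In Z the dimensions add up mod the order of G. *)
Lemma retract_degree (X Y : triangle K) : dist X -> triangle_retract Y X ->
  rdegree (tri2 Y) = (rdegree (tri1 Y) + rdegree (tri3 Y))%N %[mod #|G|].
Proof.
move=> dX rYX; have [s [r [sr1 sr2 sr3]]] := rYX.
have [C [g fg]] := cone_exists (tri12 Y).
have [h eZ] := short_exact_triangle fg.
set Z := Triangle _ _ _ in eZ; have dZ := exact_triangle_dist eZ.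
have [bi ib] := dadd_projective_iso (tri2 Y) (@mod_reg_tens_projective F gT G
  (tri1 Y)).
pose b : hom (tri2 Z) (tri2 Y) := mod_col (mod_id _) (mod_zero _ _).
have fb : tri12 Z ;; b ~= tri12 Y.
  by apply: stable_of_eq; rewrite /= mul_row_col mulmx1 mulmx0 addr0.
have [|c [gc hc]] := @dist_fill F gT G Z X (tmap1 s) (b ;; tmap2 s) eZ dX.
  by rewrite comphA fb (tmap12 s).
have cI : is_iso (c ;; tmap3 r).
  apply: (@hom_exact_five Z Y b (idh _) _ (dist_hom_exact dZ)).
  - exact: hom_exact_retract rYX (dist_hom_exact dX).
  - exact: is_iso_id.
  - by eexists; split; [exact: bi | exact: ib].
  - by rewrite comp1h.
  - by rewrite comphA gc -!comphA (tmap23 r) (comphA (tmap2 s)) sr2 comp1h.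
  rewrite -comphA -(tmap31 r) comphA -hc -comphA -shift_comp sr1.
  by [].
have := stable_iso_degree charF pG cI => cE.
have := short_exact_degree fg; rewrite /= => e.
move/(congr1 (modn^~ #|G|)): e; rewrite [(#|G| * _)%N]mulnC addnC modnMDl.
by move=> ->; rewrite -modnDmr [X in (_ + X)%N]cE modnDmr.
Qed.

End RetractedTriangles.

(** * Cyclic p-groups: the trivial module as a summand of a cone *)

Section CyclicGroups.
Variables (F : fieldType) (gT : finGroupType) (G : {group gT}).
Local Notation rep := (representation F G).
Local Notation K := (stab F G).
Local Notation hull M := (mod_tens (mod_reg F G) M).
Variable x : gT.
Hypothesis Gx : (G :=: <[x]>)%g.

Lemma gen_mem : x \in G. Proof. by rewrite Gx cycle_id. Qed.

Lemma gen_fixed (M : rep) m (W : 'M_(m, rdegree M)) : W *m M x = W ->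
  forall g, g \in G -> W *m M g = W.
Proof.
move=> Wx g; rewrite {1}Gx => /cycleP[i ->].
elim: i => [|i IH]; first by rewrite repr_mx1 mulmx1.
by rewrite expgSr repr_mxM ?groupX ?gen_mem // mulmxA IH.
Qed.

Lemma gen_fixed_col (M : rep) m (W : 'M_(rdegree M, m)) : M x *m W = W ->
  forall g, g \in G -> M g *m W = W.
Proof.
move=> Wx g; rewrite {1}Gx => /cycleP[i ->].
elim: i => [|i IH]; first by rewrite repr_mx1 mul1mx.
by rewrite expgS repr_mxM ?groupX ?gen_mem // -mulmxA IH.
Qed.

Lemma gen_sub1P (M : rep) g : g \in G ->
  M g *m (M x - 1%:M) = (M x - 1%:M) *m M g.
Proof.
move=> Gg; rewrite mulmxBr mulmxBl mulmx1 mul1mx -!repr_mxM ?gen_mem //.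
by congr (M _ - _); apply: (centsP (cycle_abelian x)); rewrite -?Gx ?gen_mem.
Qed.

(** Equivariant because G is commutative. *)
Definition gen_sub1 (M : rep) : modhom M M := ModHom (@gen_sub1P M).

Lemma gen_norm (M : rep) : M x *m mod_norm M = mod_norm M.
Proof.
rewrite mulmx_sumr [RHS](reindex_inj (mulgI x)) /=.
apply: eq_big => [g|g Gg]; first by rewrite groupMl // gen_mem.
by rewrite repr_mxM // gen_mem.
Qed.

(** Tate cohomology of a projective module vanishes. The image of x - 1 is
    contained in the kernel of the norm; as the kernel of x - 1, the space of
    fixed vectors, is contained in the image of the norm, the ranks agree. *)
Lemma projective_ker_norm (P : rep) : projective P ->
  (kermx (mod_norm P) <= P x - 1%:M)%MS.
Proof.
move=> pP; have sub : (P x - 1%:M <= kermx (mod_norm P))%MS.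
  by apply/sub_kermxP; rewrite mulmxBl mul1mx gen_norm subrr.
have kN : (kermx (P x - 1%:M) <= mod_norm P)%MS.
  apply: fixed_sub_norm => //; apply: gen_fixed; apply/eqP.
  by rewrite -subr_eq0 -[X in _ - X]mulmx1 -mulmxBr mulmx_ker.
rewrite -(geq_leqif (mxrank_leqif_sup sub)) mxrank_ker.
by have := mxrankS kN; rewrite mxrank_ker !leq_subLR addnC.
Qed.

Lemma dadd_short_exact (M N : rep) :
  short_exact (mod_inl M N) (mod_col (mod_zero M N) (mod_id N)).
Proof.
have i1 : mmx (mod_inl M N) *m col_mx 1%:M 0 = 1%:M.
  by rewrite /= mul_row_col mul0mx mulmx1 addr0.
have p1 : mmx (mod_inr M N) *m mmx (mod_col (mod_zero M N) (mod_id N)) = 1%:M.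
  by rewrite /= mul_row_col mulmx0 mulmx1 add0r.
have sf : mod_surj (mod_col (mod_zero M N) (mod_id N)).
  by apply/row_fullP; exists (mmx (mod_inr M N)).
split=> //; first by apply/row_freeP; exists (col_mx 1%:M 0).
apply/eqmxP/andP; split.
  by apply/sub_kermxP; rewrite /= mul_row_col mulmx0 mul0mx addr0.
apply/rV_subP=> v /sub_kermxP; rewrite -[v]hsubmxK mul_row_col mulmx0 add0r
  mulmx1.
move=> ->; apply/submxP; exists (lsubmx v).
by rewrite /= mul_mx_row mulmx1 mulmx0.
Qed.

Variable p : nat.
Hypotheses (charF : p \in [pchar F]) (pG : (p.-group G)%g).

(** Let C be the cone of x - 1 : M -> M, that is the quotient of the sum of M
    and kG (x) M by M. A linear form phi on M invariant under G induces a
    homomorphism psi from C to k. Choose m in M with m phi = 1. As the norm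
    kills m, the image of m in the projective module kG (x) M is y (x - 1) for
    some y. Then (m, y) (x - 1) is the image of m under the inclusion of M and
    so vanishes in C: the class of (m, y) is a fixed vector of C on which psi
    is 1, so that k is a direct summand of C. *)
Lemma norm0_thick_triv (S : set K) (M : rep) : thick S -> S M ->
  mod_norm M = 0 -> (0 < rdegree M)%N -> S (mod_triv F G).
Proof.
move=> tS SM N0 M0; have [C [g fg]] := cone_exists (gen_sub1 M).
have [SC _ _] := short_exact_thick fg tS.
have SC' : S C.
  apply: SC => //; have [_ _] := short_exact_thick (dadd_short_exact M (hull
    M)) tS.
  apply=> //; apply: thick_projective => //.
  exact: (@mod_reg_tens_projective F gT G M).
have [phi phi0 phix] : exists2 phi : 'cV[F]_(rdegree M),
  phi != 0 & M x *m phi = phi.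
  pose D := M x - 1%:M.
  have D0 : cokermx D != 0.
    rewrite -mxrank_eq0 mxrank_coker -lt0n subn_gt0 ltn_neqAle rank_leq_row
      andbT.
    have [v v0 vM] := pgroup_fixed charF pG M0.
    apply/negP=> /row_freeP[D' DD']; case/eqP: v0.
    by rewrite -[v]mulmx1 -DD' mulmxA mulmxBr mulmx1 vM ?gen_mem // subrr
      mul0mx.
  have /matrix0Pn[i [j Dij]] := D0.
  exists (col j (cokermx D)).
    by apply: contraNneq Dij => /colP/(_ i); rewrite !mxE => ->.
  apply/eqP.
  by rewrite -subr_eq0 -[X in _ - X]mul1mx -mulmxBl colE mulmxA mulmx_coker
    mul0mx.
have phiP s : s \in G -> M s *m phi = phi *m mod_triv F G s.
  by move=> Gs; rewrite mulmx1; exact: gen_fixed_col.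
pose phih : modhom M (mod_triv F G) := @ModHom _ _ _ M (mod_triv F G) phi phiP.
have [|psi psiE] := short_exact_factor_hom fg
    (a := mod_col phih (mod_zero (hull M) (mod_triv F G))).
  by rewrite /= mul_row_col mulmx0 addr0 mulmxBl phix mul1mx subrr.
have [m mphi] : exists m : 'rV_(rdegree M), m *m phi = 1%:M.
  have [i phii] : exists i, phi i 0 != 0.
    by have /cV0Pn := phi0.
  exists ((phi i 0)^-1 *: delta_mx 0 i); rewrite -scalemxAl -rowE.
  by apply/matrixP=> a b; rewrite !ord1 !mxE mulVf.
have [y yE] : exists y, m *m mmx (cosyz_inj M) = y *m (hull M x - 1%:M).
  apply/submxP; apply: submx_trans (projective_ker_norm
    (@mod_reg_tens_projective F gT G M)).
  by apply/sub_kermxP; rewrite -mulmxA -norm_hom N0 mul0mx mulmx0.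
pose v : 'rV_(rdegree C) := row_mx m y *m mmx g.
have vx : v *m C x = v.
  apply/eqP; rewrite -subr_eq0 -mulmxA -(mmxP g) ?gen_mem // mulmxA -mulmxBl.
  have -> : row_mx m y *m dadd_grepr M (hull M) x - row_mx m y =
      m *m mmx (mod_row (gen_sub1 M) (cosyz_inj M)).
    rewrite mul_row_block !mulmx0 addr0 add0r opp_row_mx add_row_mx.
    by rewrite mul_mx_row yE !mulmxBr !mulmx1.
  by rewrite -mulmxA (short_exact_comp0 fg) mulmx0.
pose e := fixed_hom (gen_fixed vx).
have epsi : mmx e *m mmx psi = 1%:M.
  by rewrite /= -mulmxA -psiE /= mul_row_col mulmx0 addr0.
have [B [j ds]] := split_mono_direct_sum epsi.
by case: tS => _ _ _ /(_ _ _ _ _ _ ds SC')[].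
Qed.

End CyclicGroups.

(** * Tensoring with a fixed module *)

Section LeftTensor.
Variables (F : fieldType) (gT : finGroupType) (G : {group gT}).
Local Notation rep := (representation F G).
Local Notation K := (stab F G).
Variable N : rep.

Lemma mod_tenslP (A B : rep) (f : modhom A B) g : g \in G ->
  mod_tens A N g *m tprod (mmx f) 1%:M = tprod (mmx f) 1%:M *m mod_tens B N g.
Proof. by move=> Gg; rewrite -!tprodE mulmx1 mul1mx mmxP. Qed.

Definition mod_tensl (A B : K) (f : hom A B) : hom (tens A N : K) (tens B N) :=
  @ModHom _ _ _ (mod_tens A N) (mod_tens B N) _ (mod_tenslP f).

Lemma mod_tensl_comp (A B C : K) (f : hom A B) (g : hom B C) :
  mod_tensl (f ;; g) ~= mod_tensl f ;; mod_tensl g.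
Proof. by apply: stable_of_eq; rewrite /= -tprodE mulmx1. Qed.

Lemma mod_tensl_id (A : K) : mod_tensl (idh A) ~= idh _.
Proof. by apply: stable_of_eq; exact: tprod1. Qed.

Lemma projective_mod_tensl (P : K) : projective P -> projective (tens P N).
Proof.
by move=> /projective_trace[t /(mod_tens_tracel N)/rel_trace_projective].
Qed.

Lemma mod_tensl_heq (A B : K) (f g : hom A B) : f ~= g ->
  mod_tensl f ~= mod_tensl g.
Proof.
case=> P [a [b [pP e]]]; exists (mod_tens P N), (@mod_tensl A P a),
  (@mod_tensl P B b).
split; first exact: projective_mod_tensl.
rewrite /= -tprodE -e mulmx1; apply/eqP.
by rewrite subr_eq -tprodDl subrK.
Qed.

#[local] Instance mod_tensl_proper (A B : K) :
  Proper (respectful (@heq K A B) (@heq K (tens A N) (tens B N))) (@mod_tensl A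
    B).
Proof. by move=> f g; exact: mod_tensl_heq. Qed.

(** Both outer maps have linear one-sided inverses, which tensor; exactness in
    the middle is then a count of dimensions. *)
Lemma mod_tensl_short_exact (A B C : rep) (f : modhom A B) (g : modhom B C) :
  short_exact f g -> short_exact (@mod_tensl A B f) (@mod_tensl B C g).
Proof.
move=> ex; have dB := short_exact_degree ex.
have fg0 := short_exact_comp0 ex; case: ex => /row_freeP[f' ff'] /row_fullP[g'
  gg'] _.
pose tf := @mod_tensl A B f; pose tg := @mod_tensl B C g.
have tff : row_free (mmx tf).
  by apply/row_freeP; exists (tprod f' 1%:M); rewrite /= -tprodE ff' mulmx1;
    exact: tprod1.
have tgs : mod_surj tg.
  by apply/row_fullP; exists (tprod g' 1%:M); rewrite /= -tprodE gg' mulmx1;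
    exact: tprod1.
have tfg0 : tprod (0 : 'M[F]_(rdegree A, rdegree C)) (1%:M : 'M[F]_(rdegree N))
  = 0.
  by apply: (addrI (tprod 0 1%:M)); rewrite -tprodDl !addr0.
have sub : (mmx tf <= kermx (mmx tg))%MS.
  by apply/sub_kermxP; rewrite /= -tprodE fg0 mulmx1.
split=> //; apply/eqmxP; rewrite -(geq_leqif (mxrank_leqif_eq sub)).
by rewrite mxrank_ker (eqP tff) (eqP tgs) /= dB mulnDl addnK.
Qed.

(** Tensoring with N is an exact functor on the stable category, and these are
    the modules that it sends to zero. *)
Lemma tens_projective_thick : thick [set A : K | projective (tens A N)].
Proof.
have tr (M M' : K) (a : hom M M') (b : hom M' M) : a ;; b ~= idh M ->
    projective (tens M' N) -> projective (tens M N).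
  move=> ab; apply: (@projective_retract F gT G (tens M N) (tens M' N)
    (mod_tensl a) (mod_tensl b)).
  by rewrite -mod_tensl_comp ab mod_tensl_id.
split=> [A /projective_is_zero|A|X [Y eY /triangle_iso_retract[[s [r [sr1 sr2
  sr3]]] [s' [r' [rs1 rs2 rs3]]]]]|A B D i j ds] /=.
- exact: projective_mod_tensl.
- have [] := short_exact_projective (mod_tensl_short_exact (cosyz_exact A)).
  have pH : projective (mod_tens (mod_tens (mod_reg F G) A) N).
    by apply: projective_mod_tensl; exact: mod_reg_tens_projective.
  by move=> h1 h2 _; split=> ?; [exact: h2 | exact: h1].
- have [ex _] := eY.
  have [h1 h2 h3] := short_exact_projective (mod_tensl_short_exact ex).
  split=> p q.
  + by apply: tr sr3 (h1 (tr _ _ _ _ rs1 p) (tr _ _ _ _ rs2 q)).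
  + by apply: tr sr1 (h2 (tr _ _ _ _ rs2 p) (tr _ _ _ _ rs3 q)).
  + by apply: tr sr2 (h3 (tr _ _ _ _ rs1 p) (tr _ _ _ _ rs3 q)).
- move=> pD; split.
    have [h [ih _] _] := ds A (idh A) (mod_zero B A); exact: tr ih pD.
  have [h [_ jh] _] := ds B (mod_zero A B) (idh B); exact: tr jh pD.
Qed.

End LeftTensor.

(** * The spectrum is a point *)

Section Spectrum.
Variables (F : fieldType) (gT : finGroupType) (G : {group gT}).
Local Notation rep := (representation F G).
Local Notation K := (stab F G).

(** The tensor product with k is N up to a change of coordinates, the degree 1
    * n of the product being n + 0 by computation. *)
Lemma tens_triv_projective (N : rep) :
  projective (mod_tens (mod_triv F G) N) -> projective N.
Proof.
pose n := rdegree N.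
have actE g : mod_tens (mod_triv F G) N g = block_mx (N g) 0 0 0 :> 'M_(n + 0,
  n + 0).
  rewrite /= -[RHS]/(col_mx _ _); congr col_mx; last by apply/matrixP=> -[].
  rewrite !mxE /= scale1r; congr row_mx.
have iP g : g \in G -> N g *m row_mx 1%:M 0 =
    (row_mx 1%:M 0 : 'M_(n, n + 0)) *m mod_tens (mod_triv F G) N g.
  by move=> Gg; rewrite actE mul_row_block mul_mx_row !mulmx0 mulmx1 mul1mx
    !addr0.
have rP g : g \in G -> mod_tens (mod_triv F G) N g *m col_mx 1%:M 0 =
    (col_mx 1%:M 0 : 'M_(n + 0, n)) *m N g.
  move=> Gg; rewrite actE mul_block_col [RHS]mul_col_mx.
  by rewrite !mulmx0 !mul0mx mulmx1 mul1mx !addr0.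
pose i : hom (N : K) (tens (mod_triv F G : K) N) :=
  @ModHom _ _ _ N (mod_tens (mod_triv F G) N) _ iP.
pose r : hom (tens (mod_triv F G : K) N) (N : K) :=
  @ModHom _ _ _ (mod_tens (mod_triv F G) N) N _ rP.
apply: (@projective_retract F gT G N (mod_tens (mod_triv F G) N) i r).
by apply: stable_of_eq; rewrite /= mul_row_col mulmx1 mul0mx addr0.
Qed.

Lemma projective_thick : thick [set A : K | projective A].
Proof.
split=> [A|A|X dX|A B D i j ds pD] /=.
- by move/projective_is_zero.
- exact: projective_shift.
- exact: dist_projective.
split.
  have [h [ih _] _] := ds A (idh A) (mod_zero B A);
    exact: projective_retract ih pD.
have [h [_ jh] _] := ds B (mod_zero A B) (idh B);
  exact: projective_retract jh pD.
Qed.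

Variables (p : nat) (x : gT).
Hypothesis Gx : (G :=: <[x]>)%g.
Hypotheses (charF : p \in [pchar F]) (pG : (p.-group G)%g).

Lemma thick_triv_full (S : set K) : thick S -> S (mod_triv F G) ->
  forall A, S A.
Proof.
move=> tS St A; have [n le_n] := ubnP (rdegree (A : rep)).
elim: n => // n IH in A le_n *.
have [A0|A0] := posnP (rdegree (A : rep)).
  by apply: thick_projective => //; exact: projective_null_degree.
have [C [f [g fg]]] := pgroup_filtration charF pG A0.
have [_ _ SA] := short_exact_thick fg tS; apply: SA => //; apply: IH.
by rewrite -ltnS (leq_trans _ le_n) // (short_exact_degree fg).
Qed.

(** By splitting off free summands M may be assumed to be killed by the norm;
    it is then nonzero since it is not projective. *)
Lemma thick_nonprojective_full (S : set K) (M : K) : thick S -> S M ->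
  ~ projective M -> forall A, S A.
Proof.
move=> tS SM nM; apply: thick_triv_full => //.
have [M' [N0 pM' _ SM']] := norm_reduction charF pG M.
apply: (norm0_thick_triv Gx charF pG tS (SM' S tS SM) N0); rewrite lt0n;
  apply/eqP=> M0.
by apply/nM/pM'; exact: projective_null_degree.
Qed.

Hypothesis G1 : (1 < #|G|)%N.

Lemma triv_nonprojective : ~ projective (mod_triv F G).
Proof.
by move=> /(projective_degree charF pG); rewrite dvdn1 gtn_eqF.
Qed.

(** If A (x) B is projective and A is not, the thick subcategory of the C with
    C (x) B projective contains A, hence everything, and in particular k, so
    that B is projective. *)
Lemma projective_prime : prime_ideal [set A : K | projective A].
Proof.
split=> [|A B|| A B] /=.
- exact: projective_thick.
- exact: projective_tens.
- by exists (mod_triv F G); exact: triv_nonprojective.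
move=> pAB; have [pA|nA] := pselect (projective A); [by left | right].
apply: tens_triv_projective.
exact: (thick_nonprojective_full (@tens_projective_thick F gT G B) pAB nA).
Qed.

Definition spc_point : Spc K := MkSpc projective_prime.

(** A thick subcategory contains the projective modules, which are the zero
    objects, and a proper one contains no others. *)
Lemma spc_pointE (P : Spc K) : P = spc_point.
Proof.
case: P => P Pp; have [tP _ [A nPA] _] := Pp.
have E : P = [set A : K | projective A].
  apply/seteqP; split=> [M PM|M /= pM]; last exact: thick_projective.
  apply: contrapT => nM; apply: nPA.
  exact: thick_nonprojective_full PM nM A.
by rewrite /spc_point; case: _ / E projective_prime => Qp; congr MkSpc;
  exact: Prop_irrelevance.
Qed.

End Spectrum.

(** * Krull dimension of a point *)

Section OnePoint.
Variables (X : topologicalType) (x : X).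
Hypothesis X1 : forall y, y = x.

Lemma one_point_setT (A : set X) : A !=set0 -> A = setT.
Proof.
case=> y Ay; apply/seteqP; split=> // z _.
by rewrite (X1 z) -(X1 y).
Qed.

Lemma one_point_krull_dim : krull_dim x = 0%:E.
Proof.
rewrite /krull_dim (_ : [set _ | _ in _] = [set 0%:E]) ?supremum1 //.
apply/seteqP; split=> [_ [n [c [irr lt _]] <-]|_ ->] /=; last first.
  exists 0%N => //; exists (fun=> closure [set x]); split=> // i _.
  have -> : closure [set x] = setT.
    by apply: one_point_setT; exists x; exact: subset_closure.
  split=> [||A B _ _ AB]; [exact: closedT | by exists x |].
  by case: (AB x I) => ?; [left | right]; move=> y _; rewrite (X1 y).
case: n irr lt => // n irr lt.
have [_ c0 _] := irr 0%N isT; have [_ c1 _] := irr 1%N isT.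
have := lt 0%N isT; rewrite (one_point_setT c0) (one_point_setT c1).
by case=> _ [].
Qed.

Lemma one_point_dim (A : set X) : dim A = if `[< A !=set0 >] then 0%:E else
  -oo%E.
Proof.
rewrite /dim; case: asboolP => [/one_point_setT ->|A0].
  rewrite (_ : [set _ | _ in _] = [set 0%:E]) ?supremum1 //.
  apply/seteqP; split=> [_ [y _ <-]|_ ->]; last by exists x;
    rewrite ?one_point_krull_dim.
  by rewrite (X1 y) one_point_krull_dim.
rewrite (_ : [set _ | _ in _] = set0) ?supremum0 //.
by apply/seteqP; split=> // d [y Ay _]; apply: A0; exists y.
Qed.

End OnePoint.

(** * Grothendieck groups of localizations and idempotent completions *)

Lemma K0_ind (T : tricat) (P : K0 T -> Prop) :
  P 0 -> (forall A, P (K0_class A)) -> (forall x y, P x -> P y -> P (x - y)) ->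
  forall z, P z.
Proof.
move=> P0 Pc PB z; have -> : z = (\pi_(K0 T) (generic_quotient.repr (z :
  Quotient.quot (subgroup_gen (@K0_relations T)))))%qT.
  exact: esym (generic_quotient.reprK (z : Quotient.quot _)).
move: (generic_quotient.repr _) => D.
have PN x : P x -> P (- x) by move=> Px; rewrite -sub0r; exact: PB.
have PD x y : P x -> P y -> P (x + y).
  by move=> Px Py; rewrite -[y]opprK; apply: PB => //; exact: PN.
have PZ A (m : int) : P (K0_class (A : T) *~ m).
  have PZn (m' : nat) : P (K0_class A *+ m').
    by elim: m' => [//|m' IH]; rewrite mulrS; apply: PD.
  by case: m => m'; [|rewrite NegzE mulrNz; apply: PN]; exact: PZn.
elim/freeg_ind_dom0: D => [|k A D _ _ PD']; first by rewrite raddf0.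
rewrite raddfD /=; apply: PD => //.
have -> : << k *g A >> = free_class (A : T) *~ k :> free_ob T.
  by rewrite /free_class freegU_mulz intz.
rewrite raddfMz; exact: PZ.
Qed.

(** In the completion any three morphisms form a retract of a distinguished
    triangle, in particular on the objects W, W, W, which gives [W] = [W] +
    [W]. *)
Lemma K0_karoubi_trivial (T : tricat) :
  (forall (A B : T) (f g : hom A B), f ~= g) -> (forall A B : T, hom A B) ->
  (exists X : triangle T, dist X) ->
  forall z : K0 (karoubi T), z = 0.
Proof.
move=> homE h [X dX]; elim/K0_ind => [//|W|x y -> ->]; last exact: subrr.
have khom (U V : karoubi T) : hom U V.
  apply: (@KaroubiHom T U V ((kidem U ;; h (kob U) (kob V)) ;; kidem V)).
  exact: homE.
pose Y : triangle (karoubi T) := Triangle (khom W W) (khom W W) (khom W (shift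
  W)).
have dY : dist Y.
  exists X => //.
  have m1 (U V : triangle (karoubi T)) : triangle_map U V.
    by apply: (@TriangleMap _ U V (khom _ _) (khom _ _) (khom _ _));
      exact: homE.
  by exists (m1 _ _), (m1 _ _); split; exact: homE.
have /(congr1 (fun u => u - K0_class W)) := K0_dist dY.
by rewrite /= subrr addrK.
Qed.

(** The P and Q exhibit idempotents r s of the triangle (f, g, h) as factoring
    through X; the splittings of the idempotents form a triangle, whose
    inclusion in X is s P and whose retraction is Q r. *)
Lemma image_triangle_retract (T : shift_category) (X : triangle T)
    (A1 A2 A3 B1 B2 B3 : T)
    (f : hom A1 A2) (g : hom A2 A3) (h : hom A3 (shift A1))
    (P1 : hom A1 (tri1 X)) (P2 : hom A2 (tri2 X)) (P3 : hom A3 (tri3 X))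
    (Q1 : hom (tri1 X) A1) (Q2 : hom (tri2 X) A2) (Q3 : hom (tri3 X) A3)
    (r1 : hom A1 B1) (r2 : hom A2 B2) (r3 : hom A3 B3)
    (s1 : hom B1 A1) (s2 : hom B2 A2) (s3 : hom B3 A3) :
  [/\ s1 ;; r1 ~= idh _, s2 ;; r2 ~= idh _ & s3 ;; r3 ~= idh _] ->
  [/\ r1 ;; s1 ~= P1 ;; Q1, r2 ;; s2 ~= P2 ;; Q2 & r3 ;; s3 ~= P3 ;; Q3] ->
  [/\ r1 ;; s1 ;; P1 ~= P1, r2 ;; s2 ;; P2 ~= P2 & r3 ;; s3 ;; P3 ~= P3] ->
  [/\ Q1 ;; (r1 ;; s1) ~= Q1, Q2 ;; (r2 ;; s2) ~= Q2 & Q3 ;; (r3 ;;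
    s3) ~= Q3] ->
  [/\ f ;; P2 ~= P1 ;; tri12 X, g ;; P3 ~= P2 ;; tri23 X
    & h ;; shifth P1 ~= P3 ;; tri31 X] ->
  [/\ tri12 X ;; Q2 ~= Q1 ;; f, tri23 X ;; Q3 ~= Q2 ;; g
    & tri31 X ;; shifth Q1 ~= Q3 ;; h] ->
  triangle_retract
    (Triangle (s1 ;; f ;; r2) (s2 ;; g ;; r3) (s3 ;; h ;; shifth r1)) X.
Proof.
move=> [sr1 sr2 sr3] [rs1 rs2 rs3] [EP1 EP2 EP3] [QE1 QE2 QE3] [p12 p23 p31].
move=> [q12 q23 q31].
have a12 : s1 ;; f ;; r2 ;; (s2 ;; P2) ~= s1 ;; P1 ;; tri12 X.
  by rewrite -comphA (comphA r2) EP2 -comphA p12 comphA.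
have a23 : s2 ;; g ;; r3 ;; (s3 ;; P3) ~= s2 ;; P2 ;; tri23 X.
  by rewrite -comphA (comphA r3) EP3 -comphA p23 comphA.
have a31 : s3 ;; h ;; shifth r1 ;; shifth (s1 ;; P1) ~= s3 ;; P3 ;; tri31 X.
  by rewrite -comphA -shift_comp comphA EP1 -comphA p31 comphA.
have b12 : tri12 X ;; (Q2 ;; r2) ~= Q1 ;; r1 ;; (s1 ;; f ;; r2).
  by rewrite comphA q12 !comphA -(comphA Q1 r1 s1) QE1.
have b23 : tri23 X ;; (Q3 ;; r3) ~= Q2 ;; r2 ;; (s2 ;; g ;; r3).
  by rewrite comphA q23 !comphA -(comphA Q2 r2 s2) QE2.
have b31 : tri31 X ;; shifth (Q1 ;; r1) ~= Q3 ;; r3 ;; (s3 ;; h ;; shifth r1).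
  by rewrite shift_comp comphA q31 !comphA -(comphA Q3 r3 s3) QE3.
set Y := Triangle _ _ _.
exists (@TriangleMap _ Y X _ _ _ a12 a23 a31), (@TriangleMap _ X Y _ _ _ b12
  b23 b31).
split=> /=.
- by rewrite comphA -(comphA s1) -rs1 -!comphA sr1 comph1.
- by rewrite comphA -(comphA s2) -rs2 -!comphA sr2 comph1.
- by rewrite comphA -(comphA s3) -rs3 -!comphA sr3 comph1.
Qed.

Section Localization.
Variables (T : tricat) (L : set T).

(** The maps z from the zero object Z become invertible. By induction on
    words, z followed by a word is again z, hence a word from A to B is the
    inverse of z at A followed by z at B. *)
Lemma verdier_trivial (Z : T) (z : forall A, hom Z A) :
  (forall A (f : hom Z A), f ~= z A) -> (forall A, verdier_inv L (z A)) ->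
  forall (A B : verdier L) (u v : hom A B), u ~= v.
Proof.
move=> zP zI; have zu A B (u : verdier_hom L A B) :
    @heq (verdier L) _ _ (VComp (VMap L (z A)) u) (VMap L (z B)).
  elim: u => {A B} [A B f|A B s hs|A B C u IHu v IHv].
  - exact: VTrans (VSym (VMapComp _ _ _)) (VMapHeq _ (zP _ _)).
  - have e : @heq (verdier L) _ _ (VMap L (z B)) (VComp (VMap L (z A)) (VMap L
      s)).
      exact: VTrans (VMapHeq _ (heq_sym (zP _ _))) (VMapComp _ _ _).
    apply: VTrans (VCongr e (VRefl _)) _; apply: VTrans (VSym (VA _ _ _)) _.
    exact: VTrans (VCongr (VRefl _) (VInvR _)) (Vh1 _).
  - exact: VTrans (VA _ _ _) (VTrans (VCongr IHu (VRefl _)) IHv).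
move=> A B u v; suff {u v} uE (u : verdier_hom L A B) :
    @heq (verdier L) _ _ u (VComp (VInv (zI A)) (VMap L (z B))).
  by rewrite (uE u) (uE v).
apply: VTrans (VSym (V1h _)) _.
apply: VTrans (VCongr (VSym (VInvL (zI A))) (VRefl _)) _.
by apply: VTrans (VSym (VA _ _ _)) _; exact: VCongr (VRefl _) (zu _ _ _).
Qed.

Hypothesis LI : forall (A B : T) (s : hom A B), verdier_inv L s -> is_iso s.

(** If the morphisms to be inverted are already isomorphisms, words can be
    evaluated in T; this is an inverse of the localization functor. *)
Fixpoint verdier_eval A B (u : verdier_hom L A B) : hom A B :=
  match u with
  | VMap _ _ f => f
  | VInv _ _ s hs => sval (cid (LI hs))
  | VComp _ _ _ u v => verdier_eval u ;; verdier_eval v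
  end.

Lemma verdier_eval_heq A B (u v : verdier_hom L A B) :
  verdier_heq u v -> verdier_eval u ~= verdier_eval v.
Proof.
elim=> {A B u v} //=.
- by move=> A B u v _; exact: heq_sym.
- by move=> A B u v w _ uv _; exact: heq_trans.
- by move=> A B C u u' v v' _ uu' _ vv'; rewrite uu' vv'.
- by move=> A B u; exact: comp1h.
- by move=> A B u; exact: comph1.
- by move=> A B C D u v w; exact: comphA.
- by move=> A B s hs; case: (cid (LI hs)) => t [].
- by move=> A B s hs; case: (cid (LI hs)) => t [].
Qed.

Lemma verdier_eval_shift A B (u : verdier_hom L A B) :
  verdier_eval (verdier_shifth u) ~= shifth (verdier_eval u).
Proof.
elim: u => {A B} [A B f|A B s hs|A B C u IHu v IHv] //=.
  case: (cid (LI (VShift hs))) => t st; case: (cid (LI hs)) => t' [st' t's] /=.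
  apply: inverse_unique st _; split; rewrite -shift_comp.
    by rewrite st' shift_id.
  by rewrite t's shift_id.
by rewrite IHu IHv shift_comp.
Qed.

Lemma verdier_evalK A B (u : verdier_hom L A B) :
  @heq (verdier L) _ _ (VMap L (verdier_eval u)) u.
Proof.
elim: u => {A B} [A B f|A B s hs|A B C u IHu v IHv] /=; first exact: VRefl.
  case: (cid (LI hs)) => t [st ts] /=.
  apply: VTrans (VSym (Vh1 _)) _.
  apply: VTrans (VCongr (VRefl _) (VSym (VInvR hs))) _.
  apply: VTrans (VA _ _ _) _.
  have e : @heq (verdier L) _ _ (VComp (VMap L t) (VMap L s)) (VMap L (idh B)).
    exact: VTrans (VSym (VMapComp _ _ _)) (VMapHeq _ ts).
  exact: VTrans (VCongr e (VRefl _)) (V1h _).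
exact: VTrans (VMapComp _ _ _) (VCongr IHu IHv).
Qed.

Hypothesis split_idem : forall (A : T) (e : hom A A), e ;; e ~= e ->
  exists (B : T) (r : hom A B) (s : hom B A), s ;; r ~= idh B /\ r ;; s ~= e.

Local Notation KV := (karoubi (verdier L)).
Local Notation ev := verdier_eval.
Local Notation emb A := (@karoubi_emb (verdier L) A : KV).

Lemma karoubi_split (W : KV) : {B : T & {r : @hom T (kob W) B & {s : @hom T B
  (kob W) |
  s ;; r ~= idh B /\ r ;; s ~= ev (kidem W)}}}.
Proof.
have /split_idem/cid[B /cid[r /cid[s rs]]] : ev (kidem W) ;;
  ev (kidem W) ~= ev (kidem W).
  exact: (verdier_eval_heq (kidemP W)).
by exists B, r, s.
Qed.

Definition split_ob (W : KV) : T := tag (karoubi_split W).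
Definition split_proj (W : KV) : @hom T (kob W) (split_ob W) :=
  tag (tagged (karoubi_split W)).
Definition split_inj (W : KV) : @hom T (split_ob W) (kob W) :=
  sval (tagged (tagged (karoubi_split W))).

Lemma split_injK W : split_inj W ;; split_proj W ~= idh _.
Proof.
by rewrite /split_inj /split_proj /split_ob; case: (karoubi_split W) =>
  B [r [s []]].
Qed.

Lemma split_projK W : split_proj W ;; split_inj W ~= ev (kidem W).
Proof.
by rewrite /split_inj /split_proj /split_ob; case: (karoubi_split W) =>
  B [r [s []]].
Qed.

(** A distinguished triangle of the completion is a retract of one of T, up to
    isomorphism in the localization. Evaluating the words in T and splitting
    the idempotents of the three objects gives a retract in T. *)
Lemma karoubi_dist_split (Y : triangle KV) : dist Y ->
  exists (X : triangle T) (f : hom (split_ob (tri1 Y)) (split_ob (tri2 Y)))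
    (g : hom (split_ob (tri2 Y)) (split_ob (tri3 Y)))
    (h : hom (split_ob (tri3 Y)) (shift (split_ob (tri1 Y)))),
    dist X /\ triangle_retract (Triangle f g h) X.
Proof.
case=> X [X0 dX0 /triangle_iso_retract[[s [r [sr1 sr2 sr3]]] _]].
case=> [m [m' [mm1 mm2 mm3]]]; exists X0.
have P1P1 : kmap (tmap1 m) ;; tmap1 s ;; (tmap1 r ;;
  kmap (tmap1 m')) ~= kidem (tri1 Y).
  by rewrite -comphA (comphA (tmap1 s)) sr1 comp1h; exact: mm1.
have P2P2 : kmap (tmap2 m) ;; tmap2 s ;; (tmap2 r ;;
  kmap (tmap2 m')) ~= kidem (tri2 Y).
  by rewrite -comphA (comphA (tmap2 s)) sr2 comp1h; exact: mm2.
have P3P3 : kmap (tmap3 m) ;; tmap3 s ;; (tmap3 r ;;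
  kmap (tmap3 m')) ~= kidem (tri3 Y).
  by rewrite -comphA (comphA (tmap3 s)) sr3 comp1h; exact: mm3.
have c12 : kmap (tri12 Y) ;; (kmap (tmap2 m) ;; tmap2 s) ~=
    kmap (tmap1 m) ;; tmap1 s ;; VMap L (tri12 X0).
  have e : kmap (tri12 Y) ;; kmap (tmap2 m) ~= kmap (tmap1 m) ;;
    tri12 X := tmap12 m.
  by rewrite comphA e -!comphA; apply: comp_heq => //; exact: (tmap12 s).
have c23 : kmap (tri23 Y) ;; (kmap (tmap3 m) ;; tmap3 s) ~=
    kmap (tmap2 m) ;; tmap2 s ;; VMap L (tri23 X0).
  have e : kmap (tri23 Y) ;; kmap (tmap3 m) ~= kmap (tmap2 m) ;;
    tri23 X := tmap23 m.
  by rewrite comphA e -!comphA; apply: comp_heq => //; exact: (tmap23 s).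
have c31 : kmap (tri31 Y) ;; shifth (kmap (tmap1 m) ;; tmap1 s) ~=
    kmap (tmap3 m) ;; tmap3 s ;; VMap L (tri31 X0).
  have e : kmap (tri31 Y) ;; shifth (kmap (tmap1 m)) ~= kmap (tmap3 m) ;;
    tri31 X := tmap31 m.
  by rewrite shift_comp comphA e -!comphA; apply: comp_heq => //;
    exact: (tmap31 s).
have d12 : (VMap L (tri12 X0) : @hom (verdier L) _ _) ;; (tmap2 r ;;
  kmap (tmap2 m')) ~=
    tmap1 r ;; kmap (tmap1 m') ;; kmap (tri12 Y).
  have e : tri12 X ;; kmap (tmap2 m') ~= kmap (tmap1 m') ;;
    kmap (tri12 Y) := tmap12 m'.
  rewrite -comphA -e !comphA; apply: comp_heq => //; exact: (tmap12 r).
have d23 : (VMap L (tri23 X0) : @hom (verdier L) _ _) ;; (tmap3 r ;;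
  kmap (tmap3 m')) ~=
    tmap2 r ;; kmap (tmap2 m') ;; kmap (tri23 Y).
  have e : tri23 X ;; kmap (tmap3 m') ~= kmap (tmap2 m') ;;
    kmap (tri23 Y) := tmap23 m'.
  rewrite -comphA -e !comphA; apply: comp_heq => //; exact: (tmap23 r).
have d31 : (VMap L (tri31 X0) : @hom (verdier L) _ _) ;; shifth (tmap1 r ;;
  kmap (tmap1 m')) ~=
    tmap3 r ;; kmap (tmap3 m') ;; kmap (tri31 Y).
  have e : tri31 X ;; shifth (kmap (tmap1 m')) ~= kmap (tmap3 m') ;;
    kmap (tri31 Y) := tmap31 m'.
  rewrite shift_comp -comphA -e !comphA; apply: comp_heq => //;
    exact: (tmap31 r).
do 3!eexists; split=> //.
apply: (@image_triangle_retract T X0 _ _ _ _ _ _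
  (ev (kmap (tri12 Y))) (ev (kmap (tri23 Y))) (ev (kmap (tri31 Y)))
  (ev (kmap (tmap1 m) ;; tmap1 s)) (ev (kmap (tmap2 m) ;; tmap2 s))
  (ev (kmap (tmap3 m) ;; tmap3 s))
  (ev (tmap1 r ;; kmap (tmap1 m'))) (ev (tmap2 r ;; kmap (tmap2 m')))
  (ev (tmap3 r ;; kmap (tmap3 m')))
  (split_proj _) (split_proj _) (split_proj _)
  (split_inj _) (split_inj _) (split_inj _)).
- by split; exact: split_injK.
- split; rewrite split_projK; symmetry.
  + exact: verdier_eval_heq P1P1.
  + exact: verdier_eval_heq P2P2.
  + exact: verdier_eval_heq P3P3.
- have l i W (u : karoubi_hom i W) (Z : verdier L) (v : hom (kob W) Z) :
      ev (kidem i) ;; ev (kmap u ;; v) ~= ev (kmap u ;; v).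
    have e : kidem i ;; (kmap u ;; v) ~= kmap u ;; v by rewrite comphA kmapl.
    exact: verdier_eval_heq e.
  split; rewrite split_projK.
  + exact: (l _ _ (tmap1 m) _ (tmap1 s)).
  + exact: (l _ _ (tmap2 m) _ (tmap2 s)).
  + exact: (l _ _ (tmap3 m) _ (tmap3 s)).
- have l i W (u : karoubi_hom W i) (Z : verdier L) (v : hom Z (kob W)) :
      ev (v ;; kmap u) ;; ev (kidem i) ~= ev (v ;; kmap u).
    have e : v ;; kmap u ;; kidem i ~= v ;; kmap u by rewrite -comphA kmapr.
    exact: verdier_eval_heq e.
  split; rewrite split_projK.
  + exact: (l _ _ (tmap1 m') _ (tmap1 r)).
  + exact: (l _ _ (tmap2 m') _ (tmap2 r)).
  + exact: (l _ _ (tmap3 m') _ (tmap3 r)).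
- split; [exact: verdier_eval_heq c12 | exact: verdier_eval_heq c23 |].
  by rewrite -verdier_eval_shift; exact: verdier_eval_heq c31.
- split; [exact: verdier_eval_heq d12 | exact: verdier_eval_heq d23 |].
  by rewrite -verdier_eval_shift; exact: verdier_eval_heq d31.
Qed.

Variable Z : T.
Hypotheses (from_zero : forall A (f g : hom Z A), f ~= g)
  (zero_dist : forall A, exists (t : hom A Z) (u : hom Z (shift A)),
    dist (Triangle (idh A) t u)).

Lemma verdier_from_zero A (u v : @hom (verdier L) Z A) : u ~= v.
Proof.
apply: VTrans (VSym (verdier_evalK u)) (VTrans _ (verdier_evalK v)).
exact: VMapHeq (from_zero _ _).
Qed.

Lemma karoubi_emb_dist (X : triangle T) : dist X ->
  K0_class (emb (tri2 X)) =
  K0_class (emb (tri1 X)) +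
  K0_class (emb (tri3 X)).
Proof.
move=> dX; have dV : @dist (verdier L) (verdier_triangle L X).
  by exists X => //; exact: triangle_iso_refl.
by have [f [g [h /K0_dist]]] := karoubi_exact dV.
Qed.

Lemma K0_class_emb_zero : K0_class (emb (Z)) = 0.
Proof.
have [t [u /karoubi_emb_dist/= e]] := zero_dist Z.
by apply: (addrI (K0_class (emb (Z)))); rewrite addr0 -e.
Qed.

(** The object W is isomorphic to the splitting B of its idempotent. The
    triangle W -> B -> 0 is then isomorphic to B -> B -> 0, so that it is
    distinguished. *)
Lemma karoubi_class_split (W : KV) :
  K0_class W = K0_class (emb (split_ob W)).
Proof.
set B := split_ob W; set r := split_proj W; set s := split_inj W.
have rs : (VMap L r : @hom (verdier L) _ _) ;; VMap L s ~= kidem W.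
  apply: VTrans (VSym (VMapComp _ _ _)) _.
  exact: VTrans (VMapHeq _ (split_projK W)) (verdier_evalK _).
have sr : (VMap L s : @hom (verdier L) _ _) ;; VMap L r ~= VMap L (idh B).
  exact: VTrans (VSym (VMapComp _ _ _)) (VMapHeq _ (split_injK W)).
have iP : (kidem W ;; VMap L r) ;; kidem (emb (B)) ~= VMap L r.
  by rewrite (comph1 (_ ;; _)) -rs -comphA sr comph1.
have jP : (kidem (emb (B)) ;; VMap L s) ;; kidem W ~= VMap L s.
  by rewrite (comp1h (VMap L s : @hom (verdier L) _ _)) -rs comphA sr comp1h.
pose i : karoubi_hom W (emb (B)) := KaroubiHom iP.
pose j : karoubi_hom (emb (B)) W := KaroubiHom jP.
have [t [u dX]] := zero_dist B.
set X0 := Triangle _ _ _ in dX.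
pose X : triangle (verdier L) := verdier_triangle L X0.
have dV : @dist (verdier L) X by exists X0 => //; exact: triangle_iso_refl.
pose w : @hom (verdier L) Z (shift (kob W)) := VMap L (u ;; shifth s).
have wP : (kidem (emb (Z)) ;; w) ;; kidem (karoubi_shift W) ~= w.
  exact: verdier_from_zero.
pose Y : triangle KV := @Triangle KV W (emb (B))
  (emb (Z)) i (karoubi_emb_hom (VMap L t : @hom (verdier L) _ _))
  (@KaroubiHom _ (emb (Z)) (karoubi_shift W) w wP).
have dY : dist Y.
  exists X => //.
  have a12 : tri12 Y ;; idh _ ~= (i : hom (tri1 Y) _) ;;
    tri12 (karoubi_triangle X).
    exact: heq_refl.
  have a31 : tri31 Y ;; shifth (i : hom (tri1 Y) (tri1 (karoubi_triangle X))) ~=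
      idh _ ;; tri31 (karoubi_triangle X) by exact: verdier_from_zero.
  have b12 : tri12 (karoubi_triangle X) ;; idh _ ~=
      (j : hom (tri1 (karoubi_triangle X)) (tri1 Y)) ;; tri12 Y.
    by rewrite comph1; symmetry; exact: sr.
  have b31 : tri31 (karoubi_triangle X) ;;
      shifth (j : hom (tri1 (karoubi_triangle X)) (tri1 Y)) ~= idh _ ;; tri31 Y.
    exact: verdier_from_zero.
  exists (@TriangleMap _ Y (karoubi_triangle X) i (idh _) (idh _) a12 (comp_idC
    _) a31).
  exists (@TriangleMap _ (karoubi_triangle X) Y j (idh _) (idh _) b12 (comp_idC
    _) b31).
  by split; [exact: rs | exact: comp1h | exact: comp1h].
by rewrite (K0_dist dY) /= K0_class_emb_zero addr0.
Qed.

End Localization.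

(** * Degrees of cycles *)

Section CycleGroups.
Variables (F : fieldType) (gT : finGroupType) (G : {group gT}).
Local Notation rep := (representation F G).
Local Notation K := (stab F G).

Definition zero_rep : rep := @grepr0 F gT G.

Lemma zero_rep_projective : projective zero_rep.
Proof. exact: projective_null_degree. Qed.

Lemma short_exact_to0 (A : rep) : short_exact (mod_id A) (mod_zero A zero_rep).
Proof.
split; first by rewrite /row_free mxrank1.
  by rewrite /mod_surj /row_full /= -leqn0 rank_leq_col.
by apply/eqmxP/andP; split; [exact/sub_kermxP/mulmx0 | exact: submx1].
Qed.

Lemma short_exact_from0 (A : rep) : short_exact (mod_zero zero_rep A) (mod_id
  A).
Proof.
split; first by rewrite /row_free /= -leqn0 rank_leq_row.
  by rewrite /mod_surj /row_full mxrank1.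
apply/eqmxP/andP; split; first by apply/sub_kermxP; rewrite /= mul0mx.
by apply/rV_subP=> v /sub_kermxP; rewrite mulmx1 => ->; exact: sub0mx.
Qed.

Variables (p : nat) (x : gT).
Hypothesis Gx : (G :=: <[x]>)%g.
Hypotheses (charF : p \in [pchar F]) (pG : (p.-group G)%g) (G1 : (1 < #|G|)%N).

(** The support of A is empty if A is projective and is the only point of the
    spectrum otherwise; the point has Krull dimension 0. *)
Lemma dim_leP l (A : K) : dim_le l A <-> projective A \/ 0 <= l.
Proof.
rewrite /dim_le /= (one_point_dim (spc_pointE Gx charF pG G1)).
case: asboolP => [[P /= nPA]|nA].
  rewrite lee_fin; split=> [|[pA|//]]; first by right.
  by case: nPA; have [tP _ _ _] := prime_predP P; exact: thick_projective.
split=> _; last exact: leNye.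
left; apply: contrapT => nA'; apply: nA.
by exists (spc_point Gx charF pG G1).
Qed.

Definition filt0 l : Kfilt K l :=
  exist _ (zero_rep : K) ((dim_leP l zero_rep).2 (or_introl
    zero_rep_projective)).

(** For i <> 0 the conditions 0 <= i and 0 <= i - 1 are equivalent, so that
    all objects of K_(i) are divided out. *)
Lemma Zcyc_trivial (i : int) : i != 0 -> forall z : Zcyc K i, z = 0.
Proof.
move=> i0; have Lall (A : Kfilt K i) : dim_le (i - 1) (sval A).
  case: A => A /= /dim_leP dA; apply/dim_leP; case: dA => [|i_ge0];
    [by left | right].
  by rewrite subr_ge0 -gtz0_ge1 lt_def i0.
apply: K0_karoubi_trivial => [|A B|].
- pose z (A : Kfilt K i) : hom (filt0 i) A := mod_zero zero_rep (sval A).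
  apply: (@verdier_trivial _ _ _ z) => [A f|A];
    first exact: projective_from zero_rep_projective.
  have [h eX] := short_exact_triangle (short_exact_from0 (sval A)).
  pose X : triangle (Kfilt K i) := @Triangle (Kfilt K i) (filt0 i) A A (z A)
    (mod_id (sval A)) h.
  have dX : dist X by exact: (exact_triangle_dist eX).
  exact: (@VCone _ _ X dX (Lall A)).
- exact: (VMap _ (mod_zero (sval A) (sval B) : @hom (Kfilt K i) A B)).
have [h eX] := short_exact_triangle (short_exact_from0 zero_rep).
pose X : triangle (Kfilt K i) := @Triangle (Kfilt K i) (filt0 i) (filt0 i)
  (filt0 i) (mod_zero zero_rep zero_rep) (mod_id zero_rep) h.
have dX : dist X by exact: (exact_triangle_dist eX).
by exists (verdier_triangle _ X), X => //; exact: triangle_iso_refl.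
Qed.

Lemma CHow_trivial (i : int) : i != 0 -> forall c : CHow K i, c = 0.
Proof.
move=> i0 c; have -> : c = cyc_class (generic_quotient.repr (c : Quotient.quot
  _)).
  exact: esym (generic_quotient.reprK (c : Quotient.quot _)).
by rewrite (Zcyc_trivial i0 (generic_quotient.repr _)) /cyc_class raddf0.
Qed.

(** By induction along the filtration with quotients k, and because the
    regular module is projective, hence has value 0. *)
Lemma additive_degree (N : zmodType) (c : K -> N) :
  (forall X : triangle K, dist X -> c (tri2 X) = c (tri1 X) + c (tri3 X)) ->
  (forall A, c A = c (mod_triv F G) *+ rdegree (A : rep)) /\
  c (mod_triv F G) *+ #|G| = 0.
Proof.
move=> cD; have cE (A B C : rep) (f : modhom A B) (g : modhom B C) :
    short_exact f g -> c B = c A + c C.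
  by case/short_exact_triangle=> h /exact_triangle_dist/cD.
have c_mod0 : c zero_rep = 0.
  by apply: (addrI (c zero_rep)); rewrite addr0 -(cE _ _ _ _ _ (short_exact_to0
    zero_rep)).
have cP (P : K) : projective P -> c P = 0.
  move=> pP; apply: (addrI (c P)); rewrite addr0.
  have [h eX] := short_exact_triangle (short_exact_to0 zero_rep).
  (* All morphisms between projective modules agree, so that the triangle P,
     P, P with zero morphisms is isomorphic to the zero triangle. *)
  set X := Triangle _ _ _ in eX.
  pose Y : triangle K := Triangle (mod_zero P P) (mod_zero P P) (mod_zero P
    (shift P)).
  have p0 (B : K) (f g : hom (zero_rep : K) B) : f ~= g.
    by rewrite (projective_from f zero_rep_projective) -(projective_from g
      zero_rep_projective).
  have zI : is_iso (mod_zero zero_rep P).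
    exists (mod_zero P zero_rep); split; first exact: p0.
    by rewrite mod_comp0; symmetry; exact: projective_from.
  have XY : triangle_iso X Y.
    by exists (@TriangleMap _ X Y (mod_zero _ _) (mod_zero _ _) (mod_zero _ _)
      (p0 _ _ _) (p0 _ _ _) (p0 _ _ _)).
  by rewrite -(cD Y) //; exists X.
have cA A : c A = c (mod_triv F G) *+ rdegree (A : rep).
  have [n le_n] := ubnP (rdegree (A : rep)).
  elim: n => // n IH in A le_n *.
  have [A0|A0] := posnP (rdegree (A : rep)).
    by rewrite A0 cP //; exact: projective_null_degree.
  have [C [f [g fg]]] := pgroup_filtration charF pG A0.
  have dA := short_exact_degree fg.
  rewrite (cE _ _ _ _ _ fg) (IH C) ?dA ?mulrS //.
  by rewrite -ltnS (leq_trans _ le_n) // dA.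
by split=> //; rewrite -(cA (mod_reg F G)) cP //; exact: mod_reg_projective.
Qed.

End CycleGroups.

Section ZeroCycles.
Variables (F : fieldType) (gT : finGroupType) (G : {group gT}).
Local Notation rep := (representation F G).
Local Notation K := (stab F G).
Variables (p q : nat) (x : gT).
Hypothesis Gx : (G :=: <[x]>)%g.
Hypotheses (charF : p \in [pchar F]) (pG : (p.-group G)%g).
Hypotheses (q1 : (1 < q)%N) (Gq : #|G| = q).

Let G1 : (1 < #|G|)%N. Proof. by rewrite Gq. Qed.

Local Notation T := (Kfilt K 0).
Local Notation L := [set a : T | dim_le (0 - 1) (sval a)].
Local Notation KV := (karoubi (Kquo K 0)).

Definition filt0_ob (A : K) : T :=
  exist _ A ((dim_leP Gx charF pG G1 0 A).2 (or_intror (lexx 0))).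

Lemma quo0_projective (A : T) : L A -> projective (sval A).
Proof. by move=> /(dim_leP Gx charF pG G1)[]. Qed.

(** The objects that are divided out are projective, and a morphism with a
    projective cone is an isomorphism. *)
Lemma quo0_iso (A B : T) (s : hom A B) : verdier_inv L s -> is_iso s.
Proof.
elim=> {A B s} [X dX /quo0_projective p3|A B s _]; last exact: is_iso_shift.
exact: (@dist_projective_iso F gT G (full_triangle X) dX p3).
Qed.

Lemma filt0_split (A : T) (e : hom A A) : e ;; e ~= e ->
  exists (B : T) (r : hom A B) (s : hom B A), s ;; r ~= idh B /\ r ;; s ~= e.
Proof. by case/(stable_idem_split (e := e))=> B [r [s rs]];
  exists (filt0_ob B), r, s. Qed.

Local Notation split W := (split_ob quo0_iso filt0_split W).
Local Notation emb A := (@karoubi_emb (Kquo K 0) (filt0_ob A) : KV).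

Definition cycle_degree (W : KV) : 'Z_q := (rdegree (sval (split W)))%:R.

Lemma natr_eq_mod m1 m2 : m1 = m2 %[mod #|G|] -> m1%:R = m2%:R :> 'Z_q.
Proof. by rewrite Gq => e; rewrite -Zp_nat_mod // e Zp_nat_mod. Qed.

(** A distinguished triangle of the completion splits to a direct factor of a
    distinguished triangle of the stable category, to which the additivity of
    dimensions applies. *)
Lemma cycle_degree_dist (Y : triangle KV) : dist Y ->
  cycle_degree (tri2 Y) = cycle_degree (tri1 Y) + cycle_degree (tri3 Y).
Proof.
move=> /(karoubi_dist_split quo0_iso filt0_split)[X [f [g [h [dX rX]]]]].
rewrite /cycle_degree -natrD; apply: natr_eq_mod.
pose Y' : triangle T := Triangle f g h.
apply: (@retract_degree F gT G p charF pG (full_triangle X) (full_triangle Y')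
  dX).
case: rX => s [r e].
exists (@TriangleMap K (full_triangle Y') (full_triangle X) _ _ _ (tmap12 s)
  (tmap23 s) (tmap31 s)).
by exists (@TriangleMap K (full_triangle X) (full_triangle Y') _ _ _ (tmap12 r)
  (tmap23 r) (tmap31 r)).
Qed.

Definition Zcyc_degree : {additive Zcyc K 0 -> 'Z_q} :=
  K0_lift cycle_degree_dist.

Definition triv_cycle : Zcyc K 0 := K0_class (emb (mod_triv F G)).

Lemma emb_cycle_dist (X : triangle K) : dist X ->
  K0_class (emb (tri2 X)) = K0_class (emb (tri1 X)) + K0_class (emb (tri3 X))
    :> Zcyc K 0.
Proof.
case: X => A B C f g h dX.
exact: (@karoubi_emb_dist T L (@Triangle T (filt0_ob A) (filt0_ob B) (filt0_ob
  C) f g h) dX).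
Qed.

Lemma emb_cycle (A : K) : K0_class (emb A) = triv_cycle *+ rdegree (A : rep).
Proof. exact: (additive_degree charF pG (c := fun A =>
  K0_class (emb A) : Zcyc K 0) emb_cycle_dist).1. Qed.

Lemma filt0_obE (A : T) : filt0_ob (sval A) = A.
Proof. by case: A => A dA; congr exist; exact: Prop_irrelevance. Qed.

Lemma emb_cycle_filt (A : T) :
  K0_class (@karoubi_emb (Kquo K 0) A : KV) = triv_cycle *+ rdegree (sval A :
    rep).
Proof. by rewrite -emb_cycle filt0_obE. Qed.

Lemma triv_cycle_order : triv_cycle *+ q = 0.
Proof. by rewrite -Gq; exact: (additive_degree charF pG (c := fun A =>
  K0_class (emb A) : Zcyc K 0) emb_cycle_dist).2. Qed.

Lemma triv_cycle_degree : Zcyc_degree triv_cycle = 1.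
Proof.
rewrite /Zcyc_degree K0_liftE -[1]/(1%:R) /cycle_degree.
apply: natr_eq_mod; set W := karoubi_emb _.
have sI : is_iso (split_inj quo0_iso filt0_split W).
  exists (split_proj quo0_iso filt0_split W); split; first exact: split_injK.
  exact: split_projK.
exact: (@stable_iso_degree F gT G p charF pG _ _ _ sI).
Qed.

(** An object of the completion has the class of the module that splits it,
    which is a multiple of the class of k. Natural multiples suffice because
    the class of k has finite order. *)
Lemma triv_cycle_gen (z : Zcyc K 0) : exists m, z = triv_cycle *+ m.
Proof.
elim/K0_ind: z => [|W|u v [m ->] [m' ->]].
- by exists 0%N; rewrite mulr0n.
- have zd (A : T) : exists (t : hom A (filt0_ob (zero_rep F G))) (u : hom
    (filt0_ob (zero_rep F G)) (shift A)),
      dist (@Triangle T A A (filt0_ob (zero_rep F G)) (idh A) t u).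
    have [h eX] := short_exact_triangle (short_exact_to0 (sval A)).
    by exists (mod_zero (sval A) (zero_rep F G)), h;
      exact: (exact_triangle_dist eX).
  have fz (A : T) (f g : hom (filt0_ob (zero_rep F G)) A) : f ~= g.
    have P0 := @zero_rep_projective F gT G.
    exact: heq_trans (@projective_from F gT G (zero_rep F G) (sval A) f P0)
      (heq_sym (@projective_from F gT G (zero_rep F G) (sval A) g P0)).
  rewrite (karoubi_class_split quo0_iso filt0_split fz zd W).
  by exists (rdegree (sval (split W))); exact: emb_cycle_filt.
(* As q times the class is 0, minus the class is (q - 1) times it. *)
exists (m + m' * q.-1)%N; rewrite mulrnDr; congr (_ + _).
apply: (addrI (triv_cycle *+ m')); rewrite subrr -mulrnDr.
by rewrite -mulnS prednK ?(ltn_trans _ q1) // mulnC mulrnA triv_cycle_order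
  mul0rn.
Qed.

Lemma Zcyc_degreeM m : Zcyc_degree (triv_cycle *+ m) = m%:R.
Proof. by rewrite raddfMn triv_cycle_degree. Qed.

Lemma Zcyc_degree_bij : bijective Zcyc_degree.
Proof.
exists (fun y : 'Z_q => triv_cycle *+ y) => [z|y];
  last by rewrite Zcyc_degreeM natr_Zp.
have [m ->] := triv_cycle_gen z; rewrite Zcyc_degreeM val_Zp_nat //.
by rewrite [in RHS](divn_eq m q) mulrnDr mulnC mulrnA triv_cycle_order mul0rn
  add0r.
Qed.

Lemma filt1_exact (X : triangle (Kfilt K (0 + 1)))
    (H := fun A : Kfilt K (0 + 1) => filt0_ob (sval A)) : dist X ->
  exists (f : hom (H (tri1 X)) (H (tri2 X))) (g : hom (H (tri2 X)) (H (tri3 X)))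
    (h : hom (H (tri3 X)) (shift (H (tri1 X)))), dist (Triangle f g h).
Proof. by exists (tri12 X), (tri23 X), (tri31 X). Qed.

(** All modules lie in both K_(0) and K_(1), so that the inclusion has an
    inverse on Grothendieck groups. *)
Lemma iotaK (u : K0 T) : K0_map filt1_exact (@Defs.iota K 0 u) = u.
Proof.
elim/K0_ind: u => [|A|u v IHu IHv]; first by rewrite !raddf0.
  by rewrite /Defs.iota K0_mapE K0_mapE /= filt0_obE.
by rewrite !raddfB IHu IHv.
Qed.

Lemma rat_equiv0_trivial (z : Zcyc K 0) : z \in @rat_equiv0 K 0 -> z = 0.
Proof.
move=> /asboolP[u u0 ->]; rewrite -(iotaK u) u0.
by rewrite !raddf0.
Qed.

Lemma Zcyc_degree_rat0 (z : Zcyc K 0) : z \in @rat_equiv0 K 0 ->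
  Zcyc_degree z = 0.
Proof. by move/rat_equiv0_trivial->; rewrite raddf0. Qed.

Definition CHow_degree : {additive CHow K 0 -> 'Z_q} :=
  quot_lift Zcyc_degree_rat0.

Lemma CHow_degreeE z : CHow_degree (cyc_class z) = Zcyc_degree z.
Proof. exact: quot_liftE. Qed.

Lemma cyc_class_repr (c : CHow K 0) :
  cyc_class (generic_quotient.repr (c : Quotient.quot _)) = c.
Proof. exact: (generic_quotient.reprK (c : Quotient.quot _)). Qed.

Lemma cyc_class_bij : bijective (@cyc_class K 0).
Proof.
have inj : injective (@cyc_class K 0).
  move=> u v e; apply: (bij_inj Zcyc_degree_bij).
  by rewrite -!CHow_degreeE e.
exists (fun c => generic_quotient.repr (c : Quotient.quot _)) => [z|];
  last exact: cyc_class_repr.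
by apply: inj; rewrite cyc_class_repr.
Qed.

Lemma CHow_degree_bij : bijective CHow_degree.
Proof.
have [g gK Kg] := cyc_class_bij.
apply: (eq_bij (f := Zcyc_degree \o g)); last first.
  by move=> c; rewrite -[in RHS](Kg c) CHow_degreeE.
by apply: bij_comp Zcyc_degree_bij _; exists (@cyc_class K 0).
Qed.

End ZeroCycles.

Theorem proposition6p3p2 (p n : nat) (k : fieldType)
    (p_pr : prime p) (n_ge1 : (1 <= n)%N) (char_k : p \in [pchar k]) :
  let K := stab k [set: 'Z_(p ^ n)]%G in
  (forall i : int, i != 0 ->
     (forall z : Zcyc K i, z = 0) /\ (forall c : CHow K i, c = 0)) /\
  (bijective (@cyc_class K 0) /\
   (exists f : {additive Zcyc K 0 -> 'Z_(p ^ n)}, bijective f) /\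
   (exists f : {additive CHow K 0 -> 'Z_(p ^ n)}, bijective f)).
Proof.
move=> K; have q1 : (1 < p ^ n)%N by rewrite -(exp1n n) ltn_exp2r ?prime_gt1.
have Gq : #|[set: 'Z_(p ^ n)]%G| = (p ^ n)%N by rewrite cardsT card_ord Zp_cast.
have G1 : (1 < #|[set: 'Z_(p ^ n)]%G|)%N by rewrite Gq.
have pG : (p.-group [set: 'Z_(p ^ n)]%G)%g by rewrite /pgroup Gq pnatX pnat_id.
have Gx := Zp_cycle (Zp_trunc (p ^ n)).+1.
split=> [i i0|].
  by split=> [z|c]; [exact: (Zcyc_trivial Gx char_k pG G1 i0 z) | exact:
    (CHow_trivial Gx char_k pG G1 i0 c)].
split; first exact: (cyc_class_bij Gx char_k pG q1 Gq).
split.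
  by exists (Zcyc_degree Gx char_k pG q1 Gq); exact: Zcyc_degree_bij.
by exists (CHow_degree Gx char_k pG q1 Gq); exact: CHow_degree_bij.
Qed.
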